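(* Let $f$ satisfy the structure conditions (i)–(vi) below and $\sigma\in(0,1)$. Let $\Sigma$ be a smooth strictly locally convex graph in $\mathbb{H}^{n+1}$ (over a bounded domain, smooth up to its boundary $\partial\Sigma$) satisfying $f(\kappa)=\sigma$ and \[ \nu^{n+1}\ge2a>0\quad\text{on }\Sigma \] for a constant $a$. For $\mathbf{x}\in\Sigma$ let $\kappa_{\max}(\mathbf{x})$ be the largest principal curvature of $\Sigma$ at $\mathbf{x}$. Then \[ \max_\Sigma\frac{\kappa_{\max}}{\nu^{n+1}-a}\le\max\Big\{\frac{4n}{a^3},\ \max_{\partial\Sigma}\frac{\kappa_{\max}}{\nu^{n+1}-a}\Big\}. \]
   Context: Half-space model $\mathbb{H}^{n+1}=\{(x,x_{n+1}):x_{n+1}>0\}$, metric $\sum dx_i^2/x_{n+1}^2$. The graph is oriented upward; $\kappa=(\kappa_1,\dots,\kappa_n)$ are its hyperbolic principal curvatures, strictly locally convex meaning all positive. $\nu^{n+1}$ is the last component of the upward Euclidean unit normal. $K_n^+=\{\lambda:\lambda_i>0\}$. Structure conditions on smooth symmetric $f$ on $K_n^+$: (i) $f_i>0$; (ii) concave; (iii) $f>0$ in $K_n^+$, $f=0$ on $\partial K_n^+$; (iv) $f(1,\dots,1)=1$; (v) homogeneous of degree one; (vi) there are $\varepsilon_0,\delta_0>0$ with $\lim_{R\to\infty}f(\lambda_1,\dots,\lambda_{n-1},\lambda_n+R)\ge1+\varepsilon_0$ uniformly on $B_{\delta_0}(1,\dots,1)$. *)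

(* Defs.v *)
From HB Require Import structures.
From mathcomp Require Import all_boot all_order all_algebra all_fingroup.
From mathcomp Require Import all_classical all_reals all_analysis.
Set Implicit Arguments. Unset Strict Implicit. Unset Printing Implicit Defensive.
Import Order.TTheory GRing.Theory Num.Theory.
Import numFieldNormedType.Exports.
Local Open Scope classical_set_scope.
Local Open Scope ring_scope.

Section Defs.
Variables (R : realType) (n : nat).
Notation V := 'rV[R]_n.

Definition ebas (i : 'I_n) : V := \row_j (if j == i then 1 else 0).
Definition elast : V := \row_j (if (j : nat) == n.-1 then 1 else 0).
Definition ones : V := \row_j 1.

Definition iterD (g : V -> R) (vs : seq V) : V -> R :=
  foldr (fun v h => fun x => 'D_v h x) g vs.

Definition smooth_on (U : set V) (g : V -> R) : Prop :=
  forall (vs : seq V) (x : V), U x -> differentiable (iterD g vs) x.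

Definition Kpos : set V := [set l | forall i, 0 < l ord0 i].
Definition Kpos_bd : set V :=
  [set l | (forall i, 0 <= l ord0 i) /\ exists i, l ord0 i = 0].

Definition structure_conditions (f : V -> R) : Prop :=
  smooth_on Kpos f /\
  (forall (s : 'S_n) (l : V), Kpos l -> f (\row_i l ord0 (s i)) = f l) /\
  (forall l i, Kpos l -> 0 < 'D_(ebas i) f l) /\
  (forall l m (t : R), Kpos l -> Kpos m -> 0 <= t <= 1 ->
     t * f l + (1 - t) * f m <= f (t *: l + (1 - t) *: m)) /\
  (forall l, Kpos l -> 0 < f l) /\ (forall l, Kpos_bd l -> f l = 0) /\
  f ones = 1 /\
  (forall (t : R) l, 0 < t -> Kpos l -> f (t *: l) = t * f l) /\
  (* (vi) lim_{R->oo} f(l_1,..,l_{n-1},l_n+R) >= 1 + eps0 uniformly on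
     the Euclidean ball B_{delta0}(1,...,1) (inside K_n^+) *)
  (exists eps0 delta0 : R, 0 < eps0 /\ 0 < delta0 /\
     forall e : R, 0 < e -> exists R0 : R, forall l (r : R),
       Kpos l -> \sum_i (l ord0 i - 1) ^+ 2 < delta0 ^+ 2 -> R0 <= r ->
       1 + eps0 - e <= f (l + r *: elast)).

(* graph of u over Omega in the half-space model *)
Definition Du (u : V -> R) (x : V) (i : 'I_n) : R := 'D_(ebas i) u x.
Definition D2u (u : V -> R) (x : V) : 'M[R]_n :=
  \matrix_(i, j) 'D_(ebas i) (fun y => 'D_(ebas j) u y) x.
Definition wgraph (u : V -> R) (x : V) : R :=
  Num.sqrt (1 + \sum_i (Du u x i) ^+ 2).
(* last component of the upward Euclidean unit normal (-Du, 1)/w *)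
Definition nu_last (u : V -> R) (x : V) : R := (wgraph u x)^-1.
Definition gammamx (u : V -> R) (x : V) : 'M[R]_n :=
  \matrix_(i, j) ((i == j)%:R -
     Du u x i * Du u x j / (wgraph u x * (1 + wgraph u x))).
(* matrix of the hyperbolic shape operator of the graph at (x, u x):
   kappa = nu^{n+1} + u * kappa^Euclid, with Euclidean curvatures the
   eigenvalues of (1/w) gamma D^2u gamma *)
Definition hyp_shape (u : V -> R) (x : V) : 'M[R]_n :=
  nu_last u x *: 1%:M +
  (u x / wgraph u x) *: (gammamx u x *m D2u u x *m gammamx u x).

Definition principal_curvatures (u : V -> R) (x : V) (kappa : V) : Prop :=
  char_poly (hyp_shape u x) = \prod_(i < n) ('X - (kappa ord0 i)%:P).

Definition kappa_max (u : V -> R) (x : V) : R :=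
  sup [set l : R | eigenvalue (hyp_shape u x) l].

Definition bounded_domain (Om : set V) : Prop :=
  open Om /\ connected Om /\ bounded_set Om /\ Om !=set0.

Definition smooth_up_to_boundary (Om : set V) (u : V -> R) : Prop :=
  exists U : set V, open U /\ closure Om `<=` U /\ smooth_on U u.

End Defs.

(* Main.v *)
(* Let M be the maximum of B(xi, xi) / (nu - a) over the closed domain and all
   unit tangent vectors, where B is the hyperbolic second fundamental form, and
   suppose that M > 4n / a^3 is attained at an interior point x0, with principal
   frame e_i and curvatures kappa_i.  Since f is concave, symmetric and
   homogeneous, the numbers c_i = f_i(kappa) satisfy sum_i c_i B(e_i, e_i) >= sigma
   at every point and for every orthonormal frame, with equality at x0 (Schur's
   inequality, proved through the assignment problem); so no differentiability of
   f as a function of the matrix B is used.  Thus, at x0, one expression is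
   maximal over points and tangent vectors and another is minimal over points and
   frames.  The second-order conditions for the minimum along e_1, with a rotating
   frame, and for the maximum along each e_i have the same fourth derivatives
   of u; eliminating these and the third derivatives gives
     0 <= sum_(i <> 1) c_i F_i + c_1 F_1
   with F_i < 0 explicit in kappa and Du, a contradiction. *)
From HB Require Import structures.
From mathcomp Require Import all_boot all_order all_algebra all_fingroup.
From mathcomp Require Import complex.
From mathcomp Require Import all_classical all_reals all_analysis.
From mathcomp Require Import ring lra.
Require Import Defs.
Set Implicit Arguments. Unset Strict Implicit. Unset Printing Implicit Defensive.
Import Order.TTheory GRing.Theory Num.Theory.
Import numFieldNormedType.Exports.
Local Open Scope classical_set_scope.
Local Open Scope ring_scope.

(** * Real symmetric matrices *)

(** In the trace inequality the summand c_1 B(e_1, e_1) is replaced, at every point, by its upper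
    bound c_1 M (nu - a). Equality persists at x0, so the new function of points and frames still
    has its minimum there, but only first derivatives of u stand in place of B(e_1, e_1).
    Differentiating along e_1 therefore yields u_11ii for i <> 1 and never u_1111, which is why the
    conditions along the e_i suffice to cancel all fourth derivatives. A test frame is a quadratic
    polynomial in t, hence orthonormal only up to o(t^2). So the trace inequality is proved for
    nearly orthonormal frames, with an error linear in the Gram defect, and the minimum criterion
    tolerates o(t^2). The rates at which the frame turns are free. Hyperbolic parallel transport is
    used while kappa_i > a; for smaller kappa_i the rate minimizing F_i is taken. As kappa_1 = M (nu
    - a) >= M a, the bound M > 4 / a^3 gives kappa_1^2 >= 2 M / a, so that kappa_i kappa_1^2
    dominates the terms of the wrong sign, which are of size M kappa_i / a. *)

Definition dotv (R : pzRingType) n (v w : 'rV[R]_n) : R := \sum_k v ord0 k * w ord0 k.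

Definition orthomx (R : pzRingType) n (Q : 'M[R]_n) : Prop := Q *m Q^T = 1%:M.

Section Dot.
Variables (R : realFieldType) (n : nat).
Implicit Types u v w : 'rV[R]_n.

Lemma dotvE v w : dotv v w = (v *m w^T) ord0 ord0.
Proof. by rewrite mxE; apply: eq_bigr => k _; rewrite mxE. Qed.

Lemma dotvC v w : dotv v w = dotv w v.
Proof. by apply: eq_bigr => k _; rewrite mulrC. Qed.

Lemma dotvDl u v w : dotv (u + v) w = dotv u w + dotv v w.
Proof. by rewrite -big_split; apply: eq_bigr => k _; rewrite mxE mulrDl. Qed.

Lemma dotvZl a v w : dotv (a *: v) w = a * dotv v w.
Proof. by rewrite /dotv big_distrr; apply: eq_bigr => k _; rewrite /= mxE mulrA. Qed.

Lemma dotvDr u v w : dotv w (u + v) = dotv w u + dotv w v.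
Proof. by rewrite !(dotvC w) dotvDl. Qed.

Lemma dotvZr a v w : dotv w (a *: v) = a * dotv w v.
Proof. by rewrite !(dotvC w) dotvZl. Qed.

Lemma dotv_ge0 v : 0 <= dotv v v.
Proof. by apply: sumr_ge0 => k _; rewrite -expr2 sqr_ge0. Qed.

Lemma dotv_eq0 v : (dotv v v == 0) = (v == 0).
Proof.
apply/idP/eqP => [|->]; last first.
  by apply/eqP; apply: big1 => k _; rewrite mxE mul0r.
rewrite psumr_eq0 => [/allP h|k _]; last by rewrite -expr2 sqr_ge0.
apply/rowP => k; rewrite mxE.
by have /= := h k (mem_index_enum k); rewrite -expr2 sqrf_eq0 => /eqP.
Qed.

Lemma dotv_gt0 v : v != 0 -> 0 < dotv v v.
Proof. by rewrite lt_def dotv_eq0 => ->; rewrite dotv_ge0. Qed.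

Lemma dotv_mulmx v w (A : 'M[R]_n) : dotv (v *m A) w = dotv v (w *m A^T).
Proof. by rewrite !dotvE trmx_mul trmxK mulmxA. Qed.

End Dot.

Section Spectral.
Variable (R : rcfType).

(* If (x + i y) A = (a + i b) (x + i y) with A symmetric, comparing (x A).y
   with x.(y A) yields b (|x|^2 + |y|^2) = 0. *)
Lemma sym_real_eigenvector n (A : 'M[R]_n.+1) : A^T = A ->
  exists (l : R) (v : 'rV[R]_n.+1), dotv v v = 1 /\ v *m A = l *: v.
Proof.
move=> symA.
suff [l [v [v0 vA]]] : exists (l : R) (v : 'rV[R]_n.+1), v != 0 /\ v *m A = l *: v.
  have d0 := dotv_gt0 v0; pose s := Num.sqrt (dotv v v).
  have s2 : s * s = dotv v v by rewrite -expr2 sqr_sqrtr // ltW.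
  have s0 : s != 0 by rewrite gt_eqF // sqrtr_gt0.
  exists l, (s^-1 *: v); split.
    by rewrite dotvZl dotvZr -s2; field.
  by rewrite -scalemxAl vA !scalerA mulrC.
have [c /eigenvalueP [z zA z0]] := @eigenvalue_closed R[i] n.+1 (map_mx (real_complex R) A) (ltn0Sn n).
case: c zA => a b zA.
pose x : 'rV[R]_n.+1 := map_mx (@complex.Re R) z.
pose y : 'rV[R]_n.+1 := map_mx (@complex.Im R) z.
have E j : (\sum_k z ord0 k * real_complex R (A k j) = (a +i* b)%C * z ord0 j).
  by move/matrixP/(_ ord0 j): zA; rewrite !mxE => <-; apply: eq_bigr => k _; rewrite mxE.
have ReS (I : finType) (F : I -> R[i]) : complex.Re (\sum_k F k) = \sum_k complex.Re (F k).
  by apply: (big_morph (@complex.Re R) (id1 := 0) (op1 := +%R)) => // -[? ?] [? ?].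
have ImS (I : finType) (F : I -> R[i]) : complex.Im (\sum_k F k) = \sum_k complex.Im (F k).
  by apply: (big_morph (@complex.Im R) (id1 := 0) (op1 := +%R)) => // -[? ?] [? ?].
have xA : x *m A = a *: x - b *: y.
  apply/rowP => j; have := congr1 (@complex.Re R) (E j); rewrite ReS !mxE.
  have -> : complex.Re ((a +i* b)%C * z ord0 j) = a * complex.Re (z ord0 j) - b * complex.Im (z ord0 j).
    by case: (z ord0 j).
  move=> <-; apply: eq_bigr => k _; rewrite mxE; case: (z ord0 k) => r i /=; ring.
have yA : y *m A = b *: x + a *: y.
  apply/rowP => j; have := congr1 (@complex.Im R) (E j); rewrite ImS !mxE.
  have -> : complex.Im ((a +i* b)%C * z ord0 j) = b * complex.Re (z ord0 j) + a * complex.Im (z ord0 j).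
    by case: (z ord0 j) => r i /=; ring.
  move=> <-; apply: eq_bigr => k _; rewrite mxE; case: (z ord0 k) => r i /=; ring.
have : dotv (x *m A) y = dotv x (y *m A) by rewrite dotv_mulmx symA.
rewrite xA yA !(dotvDl, dotvDr) -!scaleNr !(dotvZl, dotvZr) => h.
have h2 : b * (dotv x x + dotv y y) = 0 by lra.
have xy0 : (x != 0) || (y != 0).
  rewrite -negb_and; apply: contra z0 => /andP [/eqP x0 /eqP y0].
  apply/eqP/rowP => k; rewrite mxE; move/rowP/(_ k): x0; move/rowP/(_ k): y0.
  by rewrite !mxE; case: (z ord0 k) => r i /= -> ->.
have b0 : b = 0.
  move/eqP: h2; rewrite mulf_eq0 => /orP [/eqP //|].
  rewrite paddr_eq0 ?dotv_ge0 // !dotv_eq0 => /andP [x0 y0].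
  by move: xy0; rewrite x0 y0.
case/orP: xy0 => [x0|y0]; first by exists a, x; split => //; rewrite xA b0 scale0r subr0.
by exists a, y; split => //; rewrite yA b0 scale0r add0r.
Qed.

(* Householder reflection *)
Lemma orthomx_exchange n (v w : 'rV[R]_n) : dotv v v = 1 -> dotv w w = 1 ->
  exists2 H : 'M[R]_n, orthomx H & w *m H = v.
Proof.
move=> v1 w1; have [->|vw] := eqVneq v w.
  by exists 1%:M; rewrite ?mulmx1 // /orthomx mul1mx trmx1.
pose h := v - w; pose d := dotv h h.
have d0 : d != 0 by rewrite dotv_eq0 subr_eq0.
have hh : h *m h^T = d%:M.
  by apply/matrixP => i j; rewrite !ord1 -dotvE [RHS]mxE eqxx mulr1n.
pose H := 1%:M - (2 / d) *: (h^T *m h).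
have HT : H^T = H by rewrite /H linearB /= trmx1 linearZ /= trmx_mul trmxK.
exists H.
  have hhhh : h^T *m h *m (h^T *m h) = d *: (h^T *m h).
    by rewrite mulmxA -(mulmxA h^T) hh mul_mx_scalar -scalemxAl.
  rewrite /orthomx HT /H; move: (h^T *m h) hhhh => N hN.
  have hcN : ((2 / d) *: N) *m ((2 / d) *: N) = (2 / d + 2 / d) *: N.
    by rewrite -scalemxAl -scalemxAr hN !scalerA; congr (_ *: _); field.
  by rewrite mulmxBl !mulmxBr !mul1mx mulmx1 hcN scalerDl opprB addrK subrK.
rewrite /H mulmxBr mulmx1 -scalemxAr mulmxA.
have -> : w *m h^T = (dotv w h)%:M.
  by apply/matrixP => i j; rewrite !ord1 -dotvE [RHS]mxE eqxx mulr1n.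
rewrite mul_scalar_mx scalerA.
have -> : 2 / d * dotv w h = -1.
  have : d = 2 - 2 * dotv w v.
    by rewrite /d /h dotvDl !dotvDr -scaleN1r !(dotvZl, dotvZr) v1 w1 (dotvC v w); ring.
  have -> : dotv w h = dotv w v - 1 by rewrite /h dotvDr -scaleN1r dotvZr w1 mulN1r.
  by move=> dE; field: dE; rewrite d0.
by rewrite scaleN1r opprK addrC subrK.
Qed.

(** Deflation: conjugating by the reflection that takes the first basis vector to a unit eigenvector
    leaves, by symmetry, a block diagonal matrix. As vectors act from the left, the rows of [Q] are
    the eigenvectors. *)
Theorem sym_spectral n (A : 'M[R]_n) : A^T = A ->
  exists (Q : 'M[R]_n) (k : 'rV[R]_n), orthomx Q /\ A = Q^T *m diag_mx k *m Q.
Proof.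
elim: n A => [|n IH] A symA.
  by exists 1%:M, 0; split; [rewrite /orthomx mul1mx trmx1|apply/matrixP => -[]].
have [l [v [v1 vA]]] := sym_real_eigenvector symA.
pose e : 'rV[R]_(1 + n) := delta_mx 0 0.
have e1 : dotv e e = 1.
  rewrite /dotv (bigD1 ord0) //= big1 ?mxE ?eqxx ?mulr1 ?addr0 // => k k0.
  by rewrite !mxE (negbTE k0) andbF mul0r.
have [H HO eH] := orthomx_exchange v1 e1.
have HO' : H^T *m H = 1%:M by apply: mulmx1C.
pose B : 'M[R]_(1 + n) := H *m A *m H^T.
have BT : B^T = B by rewrite /B !trmx_mul trmxK symA mulmxA.
have eB : e *m B = l *: e.
  by rewrite /B !mulmxA eH vA -scalemxAl -eH -mulmxA HO mulmx1.
have B0 j : B ord0 j = l * (j == 0)%:R.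
  by move/rowP/(_ j): eB; rewrite -rowE !mxE eqxx /=.
have l0 : lshift n (0 : 'I_1) = ord0 by apply: val_inj.
have Bb : B = block_mx l%:M 0 0 (drsubmx B).
  rewrite -[LHS]submxK; congr block_mx; apply/matrixP => i j.
  - by rewrite !ord1 [RHS]mxE eqxx mulr1n [LHS]mxE [LHS]mxE l0 B0 eqxx mulr1.
  - by rewrite ord1 [RHS]mxE [LHS]mxE [LHS]mxE l0 B0 mulr0.
  by rewrite [j]ord1 -BT [RHS]mxE [LHS]mxE [LHS]mxE [LHS]mxE l0 B0 mulr0.
have symD : (drsubmx B)^T = drsubmx B.
  by rewrite -[in RHS]BT; apply/matrixP => i j; rewrite !mxE.
have [Q [k [QO Qk]]] := IH _ symD.
pose P : 'M[R]_(1 + n) := block_mx 1%:M 0 0 Q.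
have PO : orthomx P.
  rewrite /orthomx tr_block_mx mulmx_block !trmx1 !trmx0 !mulmx0 !mul0mx !mulmx1 ?addr0 add0r QO.
  by rewrite -scalar_mx_block.
exists (P *m H), (row_mx l%:M k : 'rV_(1 + n)); split.
  by rewrite /orthomx trmx_mul mulmxA -(mulmxA P) HO mulmx1.
have -> : A = H^T *m B *m H by rewrite /B !mulmxA HO' mul1mx -mulmxA HO' mulmx1.
rewrite Bb trmx_mul -!mulmxA; congr (_ *m _); rewrite !mulmxA; congr (_ *m _).
have : block_mx l%:M 0 0 (drsubmx B) = P^T *m diag_mx (row_mx l%:M k) *m P :> 'M[R]_(1 + n).
  rewrite diag_mx_row /P tr_block_mx !mulmx_block !trmx1 !trmx0 !mulmx0 !mul0mx.
  rewrite !mulmx1 ?mul1mx ?addr0 ?add0r ?mul0mx ?mulmx0 -Qk; congr block_mx.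
  by apply/matrixP => i j; rewrite !ord1 !mxE.
by move=> E; exact: E.
Qed.

End Spectral.

(** * Assignment problems and traces *)

Section Assignment.
Variable R : realFieldType.

Lemma perm_sorting n (k : 'I_n -> R) :
  exists s : 'S_n, forall i j : 'I_n, (i <= j)%N -> k (s i) <= k (s j).
Proof.
pose t := [tuple k i | i < n].
pose t' := sort <=%R t.
have szt' : size t' == n by rewrite size_sort size_tuple.
have [s ts] : exists s : 'S_n, Tuple szt' = [tuple tnth t (s i) | i < n] :> seq R.
  by apply/tuple_permP; rewrite /= perm_sort.
exists s => i j ij.
have E m : k (s m) = nth 0 t' m.
  have := congr1 (fun r => nth 0 r m) ts; rewrite /= => ->.
  rewrite -[RHS](@tnth_nth _ _ 0 [tuple tnth t (s i) | i < n] m) tnth_mktuple /t tnth_mktuple //.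
rewrite !E; apply: (@sorted_leq_nth _ <=%R) => //; first exact: le_trans.
- exact/sort_sorted/le_total.
- by rewrite inE (eqP szt').
- by rewrite inE (eqP szt').
Qed.

(** Discrete Stieltjes integral of [k] against [dc], with [c] starting from the value 0. *)
Fixpoint potential (c k : nat -> R) m : R :=
  if m is m'.+1 then potential c k m' + k m * (c m - c m') else k 0%N * c 0%N.

Section Potential.
Variables (c k : nat -> R).
Hypotheses (c_ge0 : 0 <= c 0%N) (k_ge0 : forall m, 0 <= k m).
Hypotheses (c_incr : forall m, c m <= c m.+1) (k_decr : forall m, k m.+1 <= k m).
Let a := potential c k.

Let c_homo i j : (i <= j)%N -> c i <= c j.
Proof.
elim: j => [|j IH]; first by rewrite leqn0 => /eqP ->.
by rewrite leq_eqVlt => /orP [/eqP -> //|/IH h]; apply: le_trans h _.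
Qed.

Let k_homo i j : (i <= j)%N -> k j <= k i.
Proof.
elim: j => [|j IH]; first by rewrite leqn0 => /eqP ->.
by rewrite leq_eqVlt => /orP [/eqP -> //|/IH]; apply: le_trans.
Qed.

Lemma potential_up j d : a (j + d) - a j <= k j * (c (j + d)%N - c j).
Proof.
elim: d => [|d IH]; first by rewrite addn0 !subrr mulr0.
rewrite addnS /=; have h1 := c_incr (j + d); have h2 := k_homo (leqW (leq_addr d j)).
by rewrite /a /= -/a; nra.
Qed.

Lemma potential_down i d : a i - a (i + d) <= k (i + d)%N * (c i - c (i + d)%N).
Proof.
elim: d => [|d IH]; first by rewrite addn0 !subrr mulr0.
rewrite addnS; have h1 := c_incr (i + d); have h2 := k_decr (i + d).
by have h3 := c_homo (leq_addr d i); rewrite /a /= -/a; nra.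
Qed.

(** Dual feasibility: the weights met between the two indices are at most [k j] when [j] comes
    first, and at least [k j] when [j] comes last. *)
Lemma potential_diff i j : a i - a j <= k j * (c i - c j).
Proof.
have [/subnKC <-|/ltnW/subnKC <-] := leqP j i; first exact: potential_up.
exact: potential_down.
Qed.

(** Makes the second dual variable c mu - a nonpositive, so that it pairs with upper bounds on the
    sums of [S] over its first index, while a >= 0 pairs with lower bounds on the sums over the
    second. *)
Lemma potential_ge i : k i * c i <= a i.
Proof.
elim: i => [|i IH]; first by rewrite /a.
by rewrite /a /= -/a; have h := k_decr i; have h3 := le_trans c_ge0 (c_homo (leq0n i)); nra.
Qed.

Lemma potential_le i : a i <= k 0%N * c i.
Proof.
have := potential_up 0 i; rewrite add0n [a 0%N]/a /=; lra.
Qed.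

End Potential.

(* The potentials a_i and b_k = c_k mu_k - a_k are dual feasible for the
   assignment problem with costs c_i mu_k, oppositely sorted. *)
Lemma sorted_assignment n (c mu : 'I_n -> R) (S : 'I_n -> 'I_n -> R) (K eps : R) :
  (forall i, 0 <= c i) -> (forall k, 0 <= mu k <= K) -> 0 <= eps ->
  (forall i j : 'I_n, (i <= j)%N -> c i <= c j) ->
  (forall i j : 'I_n, (i <= j)%N -> mu j <= mu i) ->
  (forall i k, 0 <= S i k) ->
  (forall i, 1 - eps <= \sum_k S i k) -> (forall k, \sum_i S i k <= 1 + eps) ->
  \sum_i c i * mu i - 2 * eps * K * \sum_i c i <= \sum_i \sum_k c i * mu k * S i k.
Proof.
case: n c mu S => [|n] c mu S c0 mu0 e0 cs mus S0 col row.
  by rewrite !big_ord0 mulr0 subr0.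
(* Both families are continued by their last value, so that monotonicity holds on all of [nat]. *)
pose C m := c (inord (minn m n)); pose M m := mu (inord (minn m n)).
have mn m : (minn m n < n.+1)%N by rewrite ltnS geq_minr.
have leC m : (minn m n <= minn m.+1 n)%N by rewrite leq_min geq_minr andbT geq_min leqnSn.
have C0 : 0 <= C 0%N by exact: c0.
have M0 m : 0 <= M m by case/andP: (mu0 (inord (minn m n))).
have Ci m : C m <= C m.+1 by apply: cs; rewrite !inordK.
have Md m : M m.+1 <= M m by apply: mus; rewrite !inordK.
have Ce (i : 'I_n.+1) : C i = c i.
  by rewrite /C (minn_idPl _) ?inord_val // -ltnS.
have Me (i : 'I_n.+1) : M i = mu i.
  by rewrite /M (minn_idPl _) ?inord_val // -ltnS.
pose a (i : 'I_n.+1) := potential C M i.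
have ad i k : a i - a k <= mu k * (c i - c k).
  by rewrite -!Ce -Me; exact: potential_diff.
have ag i : mu i * c i <= a i by rewrite -Ce -Me; exact: potential_ge.
have a0 i : 0 <= a i by apply: le_trans (ag i); rewrite mulr_ge0 //; case/andP: (mu0 i).
have aK i : a i <= K * c i.
  apply: (le_trans (potential_le Ci Md i)); rewrite Ce ler_wpM2r //.
  by case/andP: (mu0 (inord (minn 0 n))).
have step : \sum_i \sum_k (a i + (c k * mu k - a k)) * S i k <= \sum_i \sum_k c i * mu k * S i k.
  apply: ler_sum => i _; apply: ler_sum => k _; apply: ler_wpM2r => //.
  by have := ad i k; lra.
apply: le_trans step.
have -> : \sum_i \sum_k (a i + (c k * mu k - a k)) * S i k =
    \sum_i a i * \sum_k S i k + \sum_k (c k * mu k - a k) * \sum_i S i k.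
  under eq_bigr => i _ do (under eq_bigr => k _ do rewrite mulrDl; rewrite big_split /=).
  rewrite big_split /=; congr (_ + _); first by apply: eq_bigr => i _; rewrite big_distrr.
  by rewrite exchange_big /=; apply: eq_bigr => i _; rewrite big_distrr.
rewrite big_distrr /= -sumrB -big_split /=; apply: ler_sum => i _.
(* Termwise, a (1 - eps) + (c mu - a) (1 + eps) = c mu + eps (c mu - 2 a), and a <= K c: this is the
   loss 2 eps K c. *)
have h1 := ler_wpM2l (a0 i) (col i).
have b0 : 0 <= a i - c i * mu i by rewrite subr_ge0 mulrC.
have h2 := ler_wpM2l b0 (row i).
have h3 := ler_wpM2l e0 (aK i).
have h4 : 0 <= eps * (c i * mu i) by rewrite !mulr_ge0 //; case/andP: (mu0 i).
nra.
Qed.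

(** Sorting [c] upwards and [mu] downwards by two permutations reduces this to the sorted case;
    [sigma] bounds every assignment, in particular the oppositely sorted one, [s1^-1 * s2]. *)
Lemma assignment_lower_bound n (c mu : 'I_n -> R) (S : 'I_n -> 'I_n -> R) (K eps sigma : R) :
  (forall i, 0 <= c i) -> (forall k, 0 <= mu k <= K) -> 0 <= eps ->
  (forall s : 'S_n, sigma <= \sum_i c i * mu (s i)) ->
  (forall i k, 0 <= S i k) ->
  (forall i, 1 - eps <= \sum_k S i k) -> (forall k, \sum_i S i k <= 1 + eps) ->
  sigma - 2 * eps * K * \sum_i c i <= \sum_i \sum_k c i * mu k * S i k.
Proof.
move=> c0 mu0 e0 csig S0 col row.
have [s1 hs1] := perm_sorting c.
have [s2 hs2] := perm_sorting (fun k => - mu k).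
rewrite (reindex_perm s1) [X in _ <= X](reindex_perm s1) /=.
under [X in _ <= X]eq_bigr => i _ do rewrite (reindex_perm s2) /=.
have := @sorted_assignment n (c \o s1) (mu \o s2) (fun i k => S (s1 i) (s2 k)) K eps.
have -> : sigma - 2 * eps * K * (\sum_i c (s1 i)) =
  sigma - (\sum_i (c \o s1) i * (mu \o s2) i) +
  (\sum_i (c \o s1) i * (mu \o s2) i - 2 * eps * K * (\sum_i c (s1 i))) by lra.
move=> h; apply: le_trans (h _ _ e0 _ _ _ _ _).
- rewrite gerDr subr_le0 (le_trans (csig (s1^-1 * s2)%g)) // (reindex_perm s1) /=.
  by apply: ler_sum => i _; rewrite permM permK.
- by move=> i /=.
- by move=> i /=.
- by move=> i j ij /=; exact: hs1.
- by move=> i j ij /=; have := hs2 i j ij; rewrite lerN2.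
- by move=> i j.
- by move=> i; apply: (le_trans (col (s1 i))); rewrite (reindex_perm s2).
- by move=> k; apply: le_trans (row (s2 k)); rewrite [in X in _ <= X](reindex_perm s1).
Qed.

End Assignment.

(** * Schur's inequality for nearly orthonormal frames *)

Section Robust.
Variables (R : realFieldType) (n : nat).

Lemma mulmx_trE (A B : 'M[R]_n) i j : (A *m B^T) i j = dotv (row i A) (row j B).
Proof. by rewrite mxE; apply: eq_bigr => k _; rewrite !mxE. Qed.

(** Entrywise, with |z_i z_j| <= (z_i^2 + z_j^2) / 2; summing over one index brings in the factor
    n. *)
Lemma dotv_mulmx_le (T : 'M[R]_n) (z : 'rV[R]_n) eps :
  (forall i j, `|(T *m T^T) i j - (i == j)%:R| <= eps) ->
  dotv (z *m T) (z *m T) <= (1 + n%:R * eps) * dotv z z.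
Proof.
move=> hT; rewrite dotv_mulmx dotvC -mulmxA.
have E : dotv (z *m (T *m T^T)) z =
    dotv z z + \sum_j \sum_i z ord0 i * ((T *m T^T) i j - (i == j)%:R) * z ord0 j.
  rewrite /dotv -big_split /=; apply: eq_bigr => j _; rewrite mxE -big_distrl -mulrDl /=.
  congr (_ * _); under [in RHS]eq_bigr => i _ do rewrite mulrBr.
  rewrite sumrB (bigD1 j) //= [X in _ - X](bigD1 j) //= eqxx mulr1.
  rewrite [X in _ - (_ + X)]big1 => [|i /negbTE ->]; last by rewrite mulr0.
  by ring.
rewrite E mulrDl mul1r lerD2l.
have -> : n%:R * eps * dotv z z =
    \sum_j \sum_(i < n) eps * ((z ord0 i * z ord0 i + z ord0 j * z ord0 j) / 2).
  under eq_bigr => j _ do rewrite -big_distrr -big_distrl big_split /= sumr_const card_ord.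
  rewrite -big_distrr -big_distrl big_split /= sumr_const card_ord -/(dotv z z) /=.
  have -> : \sum_(i < n) z ord0 i * z ord0 i *+ n = dotv z z *+ n.
    by rewrite sumrMnl.
  by rewrite -[dotv z z *+ n]mulr_natl; field.
apply: ler_sum => j _; apply: ler_sum => i _.
have := hT i j; set x := _ - _; rewrite ler_norml => /andP [h1 h2].
have := sqr_ge0 (z ord0 i - z ord0 j); have := sqr_ge0 (z ord0 i + z ord0 j).
by set a := z _ _; set b := z _ _; nra.
Qed.

(** A matrix and its transpose have the same operator norm: for z = v T^T and q = |z|^2 = (z T).v,
    Cauchy-Schwarz gives q^2 <= |z T|^2 <= (1 + n eps) q. The Gram hypothesis controls T T^T only,
    whereas the sums over the first index need T^T. *)
Lemma dotv_mulmx_tr_le (T : 'M[R]_n) (v : 'rV[R]_n) eps : 0 <= eps ->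
  (forall i j, `|(T *m T^T) i j - (i == j)%:R| <= eps) -> dotv v v = 1 ->
  dotv (v *m T^T) (v *m T^T) <= 1 + n%:R * eps.
Proof.
move=> e0 hT v1; set z := v *m T^T; set q := dotv z z.
have zv : dotv (z *m T) v = q by rewrite dotv_mulmx.
have h1 : dotv (z *m T) (z *m T) <= (1 + n%:R * eps) * q by apply: dotv_mulmx_le.
have h2 : 0 <= dotv (z *m T - q *: v) (z *m T - q *: v) by apply: dotv_ge0.
rewrite -scaleNr !(dotvDl, dotvDr) !(dotvZl, dotvZr) v1 (dotvC v) zv in h2.
have [q0|q0] := eqVneq q 0; first by rewrite q0 addr_ge0 ?mulr_ge0.
have q1 : 0 < q by rewrite lt_def q0 dotv_ge0.
by rewrite -(ler_pM2r q1); lra.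
Qed.

Lemma quad_spectral (O T : 'M[R]_n) (mu : 'rV[R]_n) i :
  (T *m (O^T *m diag_mx mu *m O) *m T^T) i i =
  \sum_k mu ord0 k * (T *m O^T) i k ^+ 2.
Proof.
have -> : T *m (O^T *m diag_mx mu *m O) *m T^T = (T *m O^T) *m diag_mx mu *m (T *m O^T)^T.
  by rewrite trmx_mul trmxK !mulmxA.
rewrite mxE; apply: eq_bigr => k _; rewrite mul_mx_diag !mxE; ring.
Qed.

(** The squared entries of T O^T form the matrix [S] of the assignment problem. It is doubly
    stochastic when T is orthogonal, and its row and column sums are within n eps of the bounds
    needed otherwise. *)
Lemma trace_lower_bound (O T : 'M[R]_n) (mu : 'rV[R]_n) (c : 'I_n -> R) (K eps sigma : R) :
  orthomx O -> (forall k, 0 <= mu ord0 k <= K) -> (forall i, 0 <= c i) -> 0 <= eps ->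
  (forall s : 'S_n, sigma <= \sum_i c i * mu ord0 (s i)) ->
  (forall i j, `|(T *m T^T) i j - (i == j)%:R| <= eps) ->
  sigma - 2 * (n%:R * eps) * K * \sum_i c i <=
    \sum_i c i * (T *m (O^T *m diag_mx mu *m O) *m T^T) i i.
Proof.
move=> OO mu0 c0 e0 csig hT.
have OO' : O^T *m O = 1%:M by apply: mulmx1C.
have ne0 : 0 <= n%:R * eps by rewrite mulr_ge0.
have -> : \sum_i c i * (T *m (O^T *m diag_mx mu *m O) *m T^T) i i =
    \sum_i \sum_k c i * mu ord0 k * (T *m O^T) i k ^+ 2.
  apply: eq_bigr => i _; rewrite quad_spectral big_distrr /=.
  by apply: eq_bigr => k _; rewrite mulrA.
apply: assignment_lower_bound => //.
- by move=> i k; exact: sqr_ge0.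
- move=> i; have := hT i i; rewrite eqxx mulr1n ler_norml => /andP [h _].
  have -> : \sum_k (T *m O^T) i k ^+ 2 = (T *m T^T) i i.
    have -> : T *m T^T = (T *m O^T) *m (T *m O^T)^T.
      by rewrite trmx_mul trmxK mulmxA -(mulmxA T) OO' mulmx1.
    rewrite mulmx_trE.
    by apply: eq_bigr => k _; rewrite !mxE expr2.
  have n1 : 1 <= n%:R :> R by rewrite ler1n (leq_ltn_trans _ (ltn_ord i)).
  by have := ler_wpM2r e0 n1; lra.
- move=> k; have v1 : dotv (row k O) (row k O) = 1 by rewrite -mulmx_trE OO mxE eqxx.
  apply: le_trans (dotv_mulmx_tr_le e0 hT v1).
  rewrite le_eqVlt; apply/orP; left; apply/eqP.
  apply: eq_bigr => i _; rewrite expr2 -row_mul.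
  have -> : (T *m O^T) i k = (O *m T^T) k i.
    by rewrite !mxE; apply: eq_bigr => j _; rewrite !mxE mulrC.
  by congr (_ * _); rewrite [RHS]mxE.
Qed.

End Robust.

Section Rayleigh.
Variables (R : rcfType) (n : nat) (Q A : 'M[R]_n) (k : 'rV[R]_n).
Hypotheses (QO : orthomx Q) (AE : A = Q^T *m diag_mx k *m Q).

Lemma dotv_row_orth i j : dotv (row i Q) (row j Q) = (i == j)%:R.
Proof. by rewrite -mulmx_trE QO mxE. Qed.

Lemma row_eigen i : row i Q *m A = k ord0 i *: row i Q.
Proof.
rewrite AE -row_mul !mulmxA QO mul1mx; apply/rowP => j.
by rewrite mul_diag_mx !mxE.
Qed.

Lemma spectral_quad (v : 'rV[R]_n) :
  dotv (v *m A) v = \sum_i k ord0 i * dotv v (row i Q) ^+ 2.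
Proof.
have vQ i : (v *m Q^T) ord0 i = dotv v (row i Q).
  by rewrite mxE; apply: eq_bigr => j _; rewrite !mxE.
rewrite AE !mulmxA dotv_mulmx.
by apply: eq_bigr => i _; rewrite mul_mx_diag mxE vQ; ring.
Qed.

Lemma spectral_norm (v : 'rV[R]_n) : dotv v v = \sum_i dotv v (row i Q) ^+ 2.
Proof.
have vQ i : (v *m Q^T) ord0 i = dotv v (row i Q).
  by rewrite mxE; apply: eq_bigr => j _; rewrite !mxE.
rewrite -{1}[v]mulmx1 -(mulmx1C QO) mulmxA -{2}(trmxK Q) dotv_mulmx trmxK.
by apply: eq_bigr => i _; rewrite vQ expr2.
Qed.

Lemma spectral_char_poly : char_poly A = \prod_(i < n) ('X - (k ord0 i)%:P).
Proof.
have QU : Q \in unitmx by apply: (mulmx1_unit QO).1.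
have -> : char_poly A = char_poly (diag_mx k).
  have -> : A = invmx Q *m diag_mx k *m Q.
    by rewrite AE; congr (_ *m _ *m _); rewrite -[LHS]mulmx1 -(mulmxV QU) mulmxA (mulmx1C QO) mul1mx.
  rewrite /char_poly /char_poly_mx.
  have -> : 'X%:M - map_mx polyC (invmx Q *m diag_mx k *m Q) =
    map_mx polyC (invmx Q) *m ('X%:M - map_mx polyC (diag_mx k)) *m map_mx polyC Q.
    rewrite mulmxBr mulmxBl !map_mxM; congr (_ - _).
    by rewrite scalar_mxC -mulmxA -map_mxM mulVmx // map_mx1 mulmx1.
  by rewrite !det_mulmx mulrAC -det_mulmx -map_mxM mulVmx // map_mx1 det1 mul1r.
rewrite char_poly_trig; first by apply: eq_bigr => i _; rewrite mxE eqxx.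
by apply/is_trig_mxP => i j ij; rewrite mxE -val_eqE /= ltn_eqF.
Qed.

End Rayleigh.

(** * Second-order expansions in one variable *)

(** Taylor expansion with Peano remainder; [c1] and [c2] play the role of the first and second
    derivatives at 0. The limit is over full neighbourhoods of 0, so [rho 0 = 0], and the identity
    is demanded for all [t]. *)
Definition jet2 (R : realType) (phi : R -> R) (c0 c1 c2 : R) : Prop :=
  exists2 rho : R -> R, rho t @[t --> 0] --> 0 &
    forall t, phi t = c0 + c1 * t + c2 / 2 * t ^+ 2 + rho t * t ^+ 2.

Section Jets.
Variable R : realType.
Implicit Types (phi psi : R -> R) (c d : R).

Lemma jet2_eq phi psi c0 c1 c2 d0 d1 d2 : jet2 phi c0 c1 c2 ->
  phi =1 psi -> c0 = d0 -> c1 = d1 -> c2 = d2 -> jet2 psi d0 d1 d2.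
Proof. by move=> jc /funext <- <- <- <-. Qed.

Lemma jet2_cst c : jet2 (fun=> c) c 0 0.
Proof. by exists (fun=> 0) => [|t]; [exact: cvg_cst|ring]. Qed.

Lemma jet2_id : jet2 (fun t : R => t) 0 1 0.
Proof. by exists (fun=> 0) => [|t]; [exact: cvg_cst|ring]. Qed.

Let lim_add (a b : R -> R) (x y : R) : a t @[t --> (0 : R)] --> x ->
  b t @[t --> (0 : R)] --> y -> a t + b t @[t --> (0 : R)] --> x + y.
Proof. by move=> ax bx; exact: cvgD. Qed.

Let lim_mul (a b : R -> R) (x y : R) : a t @[t --> (0 : R)] --> x ->
  b t @[t --> (0 : R)] --> y -> a t * b t @[t --> (0 : R)] --> x * y.
Proof. by move=> ax bx; exact: cvgM. Qed.

Let lim_id : (t : R) @[t --> (0 : R)] --> (0 : R).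
Proof. exact: cvg_id. Qed.

Let lim_quad (c0 c1 c2 : R) : c0 + c1 * t + c2 * (t * t) @[t --> (0 : R)] --> c0.
Proof.
have cc (c : R) : (fun=> c) t @[t --> (0 : R)] --> c by exact: cvg_cst.
have := lim_add (lim_add (cc c0) (lim_mul (cc c1) lim_id)) (lim_mul (cc c2) (lim_mul lim_id lim_id)).
by rewrite !mulr0 !addr0; apply.
Qed.

Lemma jet2D phi psi c0 c1 c2 d0 d1 d2 : jet2 phi c0 c1 c2 -> jet2 psi d0 d1 d2 ->
  jet2 (fun t => phi t + psi t) (c0 + d0) (c1 + d1) (c2 + d2).
Proof.
move=> [r r0 hr] [s s0 hs]; exists (fun t => r t + s t) => [|t].
  by have := cvgD r0 s0; rewrite addr0; apply.
by rewrite hr hs; field.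
Qed.

Lemma jet2M phi psi c0 c1 c2 d0 d1 d2 : jet2 phi c0 c1 c2 -> jet2 psi d0 d1 d2 ->
  jet2 (fun t => phi t * psi t) (c0 * d0) (c0 * d1 + c1 * d0)
    (c0 * d2 + 2 * c1 * d1 + c2 * d0).
Proof.
move=> [r r0 hr] [s s0 hs].
exists (fun t => (0 + (c1 * d2 + c2 * d1) / 2 * t + c2 * d2 / 4 * (t * t)) + (c0 + c1 * t + c2 / 2 * (t * t)) * s t
   + ((d0 + d1 * t + d2 / 2 * (t * t)) + s t * (t * t)) * r t) => [|t].
  have := lim_add (lim_add (@lim_quad 0 ((c1 * d2 + c2 * d1) / 2) (c2 * d2 / 4)) (lim_mul (@lim_quad c0 c1 (c2 / 2)) s0))
    (lim_mul (lim_add (@lim_quad d0 d1 (d2 / 2)) (lim_mul s0 (lim_mul lim_id lim_id))) r0).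
  by rewrite !mulr0 !addr0; apply.
by rewrite hr hs; field.
Qed.

Lemma jet2Z phi k c0 c1 c2 : jet2 phi c0 c1 c2 ->
  jet2 (fun t => k * phi t) (k * c0) (k * c1) (k * c2).
Proof.
by move=> j; apply: (jet2_eq (jet2M (jet2_cst k) j)) => //; ring.
Qed.

Lemma jet2B phi psi c0 c1 c2 d0 d1 d2 : jet2 phi c0 c1 c2 -> jet2 psi d0 d1 d2 ->
  jet2 (fun t => phi t - psi t) (c0 - d0) (c1 - d1) (c2 - d2).
Proof.
move=> jc jd; apply: (jet2_eq (jet2D jc (jet2Z (-1) jd))) => [t|||]; ring.
Qed.

Lemma jet2_sum (I : finType) (P : pred I) (phi : I -> R -> R) (c0 c1 c2 : I -> R) :
  (forall i, P i -> jet2 (phi i) (c0 i) (c1 i) (c2 i)) ->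
  jet2 (fun t => \sum_(i | P i) phi i t) (\sum_(i | P i) c0 i)
    (\sum_(i | P i) c1 i) (\sum_(i | P i) c2 i).
Proof.
move=> h; elim: (index_enum I) => [|x r IH].
  by apply: (jet2_eq (jet2_cst 0)) => [t|||]; rewrite big_nil.
case Px: (P x); last by apply: (jet2_eq IH) => [t|||]; rewrite big_cons Px.
by apply: (jet2_eq (jet2D (h x Px) IH)) => [t|||]; rewrite big_cons Px.
Qed.

Lemma jet2_continuous phi c0 c1 c2 : jet2 phi c0 c1 c2 -> phi t @[t --> 0] --> c0.
Proof.
move=> [r r0 hr].
have := lim_add (@lim_quad c0 c1 (c2 / 2)) (lim_mul r0 (lim_mul lim_id lim_id)).
rewrite !mulr0 !addr0 => h; rewrite (_ : phi = fun t => c0 + c1 * t + c2 / 2 * (t * t) + r t * (t * t)) //.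
by apply/funext => t; rewrite hr !expr2.
Qed.

(** With q the claimed quadratic polynomial, sqrt phi - q = (phi - q^2) / (sqrt phi + q), and phi -
    q^2 is t^2 times a function that tends to 0, called [num] below. *)
Lemma jet2_sqrt phi d0 d1 d2 c : (forall t, 0 < phi t) -> 0 < c -> d0 = c ^+ 2 ->
  jet2 phi d0 d1 d2 ->
  jet2 (fun t => Num.sqrt (phi t)) c (d1 / (2 * c)) ((d2 - d1 ^+ 2 / (2 * c ^+ 2)) / (2 * c)).
Proof.
move=> phi0 c0 dc jp; have cphi := jet2_continuous jp; have [r r0 hr] := jp.
set c1 := d1 / (2 * c); set c2 := _ / (2 * c).
have cne : c != 0 by rewrite gt_eqF.
have e1 : d1 = 2 * c * c1 by rewrite /c1; field.
have e2 : d2 = 2 * c1 ^+ 2 + 2 * c * c2 by rewrite /c1 /c2; field.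
have cw : Num.sqrt (phi t) @[t --> 0] --> c.
  have -> : c = Num.sqrt d0 by rewrite dc sqrtr_sqr gtr0_norm.
  by apply: continuous_cvg => //; exact: sqrt_continuous.
pose q t := c + c1 * t + c2 / 2 * (t * t).
have cq : q t @[t --> 0] --> c.
  exact: (@lim_quad c c1 (c2 / 2)).
pose num t := r t + (0 + - (c1 * c2) * t + - (c2 ^+ 2 / 4) * (t * t)).
have cnum : num t @[t --> 0] --> 0.
  by have := lim_add r0 (@lim_quad 0 (- (c1 * c2)) (- (c2 ^+ 2 / 4))); rewrite addr0; apply.
(* The denominator tends to 2 c. Where it vanishes, away from 0, the remainder is read off from the
   identity that it must satisfy. *)
pose rho t := if Num.sqrt (phi t) + q t == 0 then (Num.sqrt (phi t) - q t) / t ^+ 2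
  else num t / (Num.sqrt (phi t) + q t).
have qE t : c + c1 * t + c2 / 2 * t ^+ 2 = q t by rewrite /q expr2.
exists rho => [|t]; last first.
  rewrite /rho qE; case: eqVneq => [s0|s0].
    have [tE|tn0] := eqVneq t 0; last by field.
    by move/eqP: s0; rewrite gt_eqF // tE /q !mulr0 !addr0 ltr_wpDl ?sqrtr_ge0.
  apply: (mulIf s0); rewrite mulrDl mulrAC divfK //.
  have sq : Num.sqrt (phi t) ^+ 2 = phi t by rewrite sqr_sqrtr // ltW.
  have -> : Num.sqrt (phi t) * (Num.sqrt (phi t) + q t) = phi t + Num.sqrt (phi t) * q t.
    by rewrite mulrDr -expr2 sq.
  by rewrite hr dc e2 e1 /num /q; field.
have cden : Num.sqrt (phi t) + q t @[t --> 0] --> c + c by apply: cvgD.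
have cc0 : c + c != 0 by rewrite gt_eqF // addr_gt0.
have crat : num t / (Num.sqrt (phi t) + q t) @[t --> 0] --> 0.
  by have := cvgM cnum (cvgV cc0 cden); rewrite mul0r; apply.
apply: cvg_trans crat; apply: near_eq_cvg.
have : \forall t \near (0 : R), 0 < q t by apply: (cvgr_gt _ cq).
apply: filterS => t q0; rewrite /rho ifN // gt_eqF //.
by rewrite ltr_wpDl ?sqrtr_ge0.
Qed.

(** Nonnegativity up to o(t^2) already gives the first- and second-order conditions; frames that are
    orthonormal up to o(t^2) provide no more than that. *)
Lemma jet2_min phi c0 c1 c2 : jet2 phi c0 c1 c2 -> c0 = 0 ->
  (forall e, 0 < e -> \forall t \near 0, - e * t ^+ 2 <= phi t) -> c1 = 0 /\ 0 <= c2.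
Proof.
move=> [r r0 hr] c00 hmin; subst c0.
have key e : 0 < e -> exists2 d, 0 < d & forall t, `|t| < d ->
    0 <= c1 * t + (c2 / 2 + 2 * e) * t ^+ 2.
  move=> e0; have h1 := hmin e e0.
  have h2 : \forall t \near (0 : R), `|r t| <= e.
    by move/cvgr0_norm_le: r0 => /(_ e e0).
  have [d d0 hd] := (nbhs_ballP _ _).1 (filterI h1 h2).
  exists d => // t td; have [|a b] := hd t.
    by rewrite /ball /= sub0r normrN.
  move: a b; rewrite /= hr ler_norml => a /andP [b b'].
  have := ler_wpM2r (sqr_ge0 t) b'; lra.
have c10 : c1 = 0.
  apply: contrapT => /eqP c1n; have [d d0 hd] := key 1 ltr01.
  have c11 : 0 < `|c1| by rewrite normr_gt0.
  pose B := `|c2 / 2 + 2| + 1; have B0 : 0 < B by rewrite ltr_wpDl.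
  (* At t = - s c1 the linear term is - s c1^2; the choice of [s] keeps |t| < d and the quadratic
     term below half of it. *)
  pose s := Num.min (B^-1 / 2) (d / `|c1| / 2).
  have s0 : 0 < s by rewrite lt_min !divr_gt0 // invr_gt0.
  have := hd (- s * c1); rewrite normrM normrN (gtr0_norm s0).
  have sd : s <= d / `|c1| / 2 by rewrite ge_min lexx orbT.
  have sB : s <= B^-1 / 2 by rewrite ge_min lexx.
  have dd : s * `|c1| < d.
    have := ler_wpM2r (ltW c11) sd; rewrite mulrAC divfK ?gt_eqF // => h.
    by apply: (le_lt_trans h); lra.
  move=> /(_ dd); rewrite mulr1.
  have -> : c1 * (- s * c1) + (c2 / 2 + 2) * (- s * c1) ^+ 2 =
    - (s * c1 ^+ 2) * (1 - s * (c2 / 2 + 2)) by ring.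
  have c12 : 0 < c1 ^+ 2 by rewrite exprn_even_gt0.
  have sb : s * (c2 / 2 + 2) <= 1 / 2.
    have h1 : c2 / 2 + 2 <= B by rewrite /B; have := ler_norm (c2 / 2 + 2); lra.
    have h2 := ler_wpM2l (ltW s0) h1; have h3 := ler_wpM2r (ltW B0) sB.
    rewrite mulrAC mulVf ?gt_eqF // in h3; lra.
  have : 0 < s * c1 ^+ 2 by rewrite mulr_gt0.
  move=> h1 h2; have : s * c1 ^+ 2 * (1 - s * (c2 / 2 + 2)) > 0 by rewrite mulr_gt0 //; lra.
  lra.
split => //; rewrite leNgt; apply/negP => c2n.
(* Turns the coefficient c2 / 2 + 2 e into c2 / 4 < 0. *)
have [|d d0 hd] := key (- c2 / 8); first by lra.
have := hd (d / 2); rewrite c10 mul0r add0r gtr0_norm ?divr_gt0 //.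
have dd : d / 2 < d by lra.
move=> /(_ dd); have : 0 < (d / 2) ^+ 2 by rewrite exprn_gt0 // divr_gt0.
by nra.
Qed.

End Jets.

(** * Directional derivatives *)

Section Mvt.
Variable R : realType.

Lemma mvt_at0 (f df : R -> R) (t : R) :
  (forall s : R, `|s| <= `|t| -> is_derive s 1 f (df s)) ->
  exists2 c, `|c| <= `|t| & f t - f 0 = df c * t.
Proof.
move=> h.
have main (a b : R) : a <= b -> (forall s : R, s \in `[a, b] -> `|s| <= `|t|) ->
    exists2 c, `|c| <= `|t| & f b - f a = df c * (b - a).
  move=> ab hs.
  have d1 x : x \in `]a, b[ -> is_derive x 1 f (df x).
    by move=> xab; apply: h; apply: hs; apply: subset_itv_oo_cc.
  have d2 : {within `[a, b], continuous f}.
    by apply: derivable_within_continuous => x xab; case: (h _ (hs _ xab)).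
  by have [c cab E] := MVT_segment ab d1 d2; exists c; first exact: hs.
have [t0|t0] := leP 0 t.
  have [|c ct E] := main 0 t t0; last by exists c => //; rewrite E subr0.
  by move=> s; rewrite in_itv /= => /andP [s0 st]; rewrite !ger0_norm.
have [|c ct E] := main t 0 (ltW t0); last first.
  by exists c => //; rewrite -opprB E sub0r mulrN opprK.
by move=> s; rewrite in_itv /= => /andP [s0 st]; rewrite !ler0_norm ?lerN2 // ltW.
Qed.

Lemma diff_approx (V W : normedModType R) (f : V -> W) (x : V) : differentiable f x ->
  forall e, 0 < e -> exists2 d : R, 0 < d &
    forall h, `|h| < d -> `|f (x + h) - f x - 'd f x h| <= e * `|h|.
Proof.
move=> /diff_locally/eqaddoP dfx e e0.
have /nbhs_norm0P [d d0 hd] := dfx e e0.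
exists d => // h hh; have := hd h hh.
by rewrite /= !fctE /= opprD addrA (addrC h).
Qed.

(** The remainder [th] has derivative df s - df 0 - q s = o(s), which the mean value theorem
    integrates to o(t^2). No second derivative away from 0 is involved. *)
Lemma jet2_derive (f df : R -> R) :
  (\forall t \near (0 : R), is_derive (t : R) (1 : R) f (df t)) -> derivable df 0 (1 : R) ->
  jet2 f (f 0) (df 0) ('D_1 df 0).
Proof.
move=> /nbhs_norm0P [d d0 hd] ddf; set q := 'D_1 df 0.
pose th t := f t - (f 0 + df 0 * t + q / 2 * t ^+ 2).
exists (fun t => th t / t ^+ 2) => [|t]; last first.
  have [->|t0] := eqVneq t 0; first by rewrite expr0n /= !mulr0 !addr0.
  by rewrite divfK ?expf_neq0 // /th; ring.
apply/cvgr0Pnorm_le => e e0.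
suff : \forall t \near (0 : R), `|th t / t ^+ 2| <= e by [].
apply/nbhs_norm0P.
have dfd : differentiable df 0 by apply/derivable1_diffP.
have [d' d'0 hd'] := diff_approx dfd e0.
exists (Num.min d d') => [|t]; first by rewrite /= lt_min d0.
rewrite /= lt_min => /andP [td td'].
have [->|t0] := eqVneq t 0; first by rewrite expr0n /= invr0 mulr0 normr0 ltW.
have [|c ct E] := @mvt_at0 th (fun s => df s - df 0 - q * s) t.
  move=> s st; have sd : `|s| < d by exact: le_lt_trans td.
  have hs := hd s sd.
  rewrite /th.
  have -> : df s - df 0 - q * s = df s - (df 0 + q * s) by ring.
  apply: is_deriveB.
  have h2 : is_derive s 1 (fun s => df 0 * s) (df 0).
    by rewrite -[X in is_derive _ _ _ X]mulr1; apply: is_deriveZ.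
  have h3 : is_derive s 1 (fun s => q / 2 * s ^+ 2) (q * s).
    have -> : q * s = q / 2 * (2 * s) by field.
    apply: is_deriveZ; have -> : (fun s : R => s ^+ 2) = (@id R) * (@id R).
      by apply/funext => y; rewrite expr2.
    apply: is_derive_eq; rewrite /GRing.scale /=; ring.
  have h1 : is_derive s 1 (fun=> f 0) (0 : R) by exact: is_derive_cst.
  by have := is_deriveD (is_deriveD h1 h2) h3; rewrite add0r; apply.
have th0 : th 0 = 0 by rewrite /th expr0n /=; ring.
rewrite th0 subr0 in E.
have cd' : `|c| < d' by exact: le_lt_trans td'.
have dc : 'd df 0 c = q * c.
  by rewrite -{1}[c]mulr1 -[c * 1]/(c *: (1 : R)) linearZ -deriveE // mulrC.
have := hd' c cd'; rewrite add0r dc => hc.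
rewrite normrM normfV normrX ler_pdivrMr ?exprn_gt0 ?normr_gt0 // E normrM expr2 mulrA.
by apply: ler_wpM2r => //; apply: (le_trans hc); rewrite ler_wpM2l // ltW.
Qed.
End Mvt.

Section Directional.
Variables (R : realType) (V : normedModType R).
Implicit Types (g : V -> R) (x v w z : V).

Lemma is_derive_line g x z (t : R) : differentiable g (x + t *: z) ->
  is_derive t 1 (fun s => g (x + s *: z)) ('D_z g (x + t *: z)).
Proof.
move=> dg; have E : (fun h : R => h^-1 *: (((fun s => g (x + s *: z)) \o shift t) (h *: 1) - g (x + t *: z))) =
    (fun h : R => h^-1 *: ((g \o shift (x + t *: z)) (h *: z) - g (x + t *: z))).
  apply/funext => h /=; congr (_ *: (g _ - _)).
  by rewrite [h *: 1]mulr1 scalerDl addrCA.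
have := @diff_derivable _ _ _ _ _ z dg; rewrite /derivable -E => d1.
by apply: DeriveDef => //; rewrite /derive E.
Qed.

Lemma derive_linear g x v w a : differentiable g x ->
  'D_(a *: v + w) g x = a * 'D_v g x + 'D_w g x.
Proof. by move=> dg; rewrite !deriveE // linearP. Qed.

(** The mean value theorem along v leaves the difference of ['D_v g] at x + c v + t w and x + c v,
    which differentiability of ['D_v g] at x evaluates. As the second difference is symmetric in v
    and w, commutation of derivatives follows. *)
Lemma second_difference g x v w : (\forall y \near x, differentiable g y) ->
  differentiable ('D_v g) x ->
  forall e, 0 < e -> \forall t \near (0 : R),
    `|g (x + t *: v + t *: w) - g (x + t *: v) - g (x + t *: w) + g x
      - t ^+ 2 * 'D_w ('D_v g) x| <= e * t ^+ 2.
Proof.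
move=> /nbhs0P/nbhs_norm0P [d d0 hd] ddg e e0.
pose M := 2 * (`|v| + `|w|) + 1.
have M0 : 0 < M by rewrite /M; have := normr_ge0 v; have := normr_ge0 w; lra.
have eM : 0 < e / M by rewrite divr_gt0.
have [d' d'0 hd'] := diff_approx ddg eM.
apply/nbhs_norm0P; exists (Num.min d d' / M) => [|t].
  by rewrite /= divr_gt0 // lt_min d0.
rewrite /= ltr_pdivlMr // lt_min => /andP [td td'].
have small s b : `|s| <= `|t| -> `|b| <= 1 -> `|s *: v + (b * t) *: w| <= `|t| * (`|v| + `|w|).
  move=> st b1; apply: (le_trans (ler_normD _ _)); rewrite !normrZ.
  rewrite mulrDr.
  apply: lerD; first by rewrite ler_wpM2r.
  by rewrite ler_wpM2r // ler_piMl.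
have tvw : `|t| * (`|v| + `|w|) <= `|t| * M.
  by rewrite ler_wpM2l // /M; have := normr_ge0 v; have := normr_ge0 w; lra.
pose psi s := g (x + t *: w + s *: v) - g (x + s *: v).
have [|c ct E] := @mvt_at0 R psi (fun s => 'D_v g (x + t *: w + s *: v) - 'D_v g (x + s *: v)) t.
  move=> s st; apply: is_deriveB; apply: is_derive_line.
    rewrite -addrA (addrC (t *: w)); apply: hd => /=.
    rewrite -[t in _ + t *: w]mul1r; apply: (le_lt_trans (small s 1 st _)); rewrite ?normr1 //.
    exact: (le_lt_trans tvw).
  apply: hd => /=; rewrite -[_ *: v]addr0 -(scale0r w) -(mul0r t).
  apply: (le_lt_trans (small s 0 st _)); rewrite ?normr0 //.
  exact: (le_lt_trans tvw).
have h1 := hd' (c *: v + (1 * t) *: w); have h0 := hd' (c *: v + (0 * t) *: w).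
have s1 := small c 1 ct; have s0 := small c 0 ct.
rewrite normr1 lexx in s1; rewrite normr0 ler01 in s0.
have {}h1 := h1 (le_lt_trans (le_trans (s1 isT) tvw) td').
have {}h0 := h0 (le_lt_trans (le_trans (s0 isT) tvw) td').
have {}h1 := le_trans h1 (ler_wpM2l (ltW eM) (s1 isT)).
have {}h0 := le_trans h0 (ler_wpM2l (ltW eM) (s0 isT)).
rewrite mul1r linearD !linearZ /= in h1; rewrite mul0r scale0r addr0 linearZ /= in h0.
have -> : 'D_w ('D_v g) x = 'd ('D_v g) x w by rewrite deriveE.
have -> : g (x + t *: v + t *: w) - g (x + t *: v) - g (x + t *: w) + g x = psi t - psi 0.
  by rewrite /psi scale0r !addr0 (addrAC x); ring.
rewrite E.
have -> : x + t *: w + c *: v = x + (c *: v + t *: w) by rewrite addrAC addrA.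
set A := 'D_v g (x + (c *: v + t *: w)) in h1 *; set B := 'D_v g (x + c *: v) in h0 *.
set L := 'd _ x w in h1 *; set L' := 'd _ x v in h1 h0; set G := 'D_v g x in h1 h0.
have -> : (A - B) * t - t ^+ 2 * L = ((A - G - (c * L' + t * L)) - (B - G - c * L')) * t by ring.
rewrite normrM -[t ^+ 2]real_normK ?num_real // expr2 mulrA ler_wpM2r //.
apply: (le_trans (ler_normB _ _)).
apply: (le_trans (lerD h1 h0)).
have -> : e * `|t| = e / M * (`|t| * M) by field; rewrite gt_eqF.
rewrite -mulrDr ler_pM2l // -mulrDr ler_wpM2l // /M; lra.
Qed.

Theorem derive_comm g x v w : (\forall y \near x, differentiable g y) ->
  differentiable ('D_v g) x -> differentiable ('D_w g) x ->
  'D_w ('D_v g) x = 'D_v ('D_w g) x.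
Proof.
move=> dg dv dw; apply/eqP; rewrite -subr_eq0 -normr_le0; apply/ler_addgt0Pr => e e0.
have e2 : 0 < e / 2 by rewrite divr_gt0.
have h1 := second_difference w dg dv e2; have h2 := second_difference v dg dw e2.
have [d /= d0 hd] := nbhs_norm0P.1 (filterI h1 h2).
have [|a b] := hd (d / 2); first by rewrite /= gtr0_norm ?divr_gt0 //; lra.
have t0 : 0 < (d / 2) ^+ 2 by rewrite exprn_gt0 // divr_gt0.
rewrite add0r -(ler_pM2r t0) -[X in _ * X <= _](gtr0_norm t0) -normrM.
set t := d / 2 in a b t0 *; rewrite /= in a b.
have E1 : x + t *: w + t *: v = x + t *: v + t *: w by rewrite addrAC.
rewrite E1 in b.
have key (A B G0 G1 G2 G3 T E : R) : `|G1 - G2 - G3 + G0 - T * A| <= E ->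
    `|G1 - G3 - G2 + G0 - T * B| <= E -> `|(A - B) * T| <= E + E.
  move=> hA hB; have -> : (A - B) * T = (G1 - G3 - G2 + G0 - T * B) - (G1 - G2 - G3 + G0 - T * A).
    by ring.
  by apply: (le_trans (ler_normB _ _)); apply: (le_trans (lerD hB hA)).
by apply: (le_trans (key _ _ _ _ _ _ _ _ a b)); rewrite -mulrDl -splitr.
Qed.

End Directional.

Section IterD.
Variables (R : realType) (n : nat) (U : set 'rV[R]_n) (u : 'rV[R]_n -> R).
Hypotheses (oU : open U) (su : smooth_on U u).
Implicit Types (s p : seq 'rV[R]_n) (x v w z : 'rV[R]_n).

Lemma iterD_derive s s' v x : (forall y, U y -> iterD u s y = iterD u s' y) ->
  U x -> iterD u (v :: s) x = iterD u (v :: s') x.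
Proof.
move=> h Ux; apply: near_eq_derive; near=> y; apply: h; near: y.
exact: open_nbhs_nbhs.
Unshelve. all: by end_near. Qed.

Lemma iterD_swap s v w x : U x -> iterD u [:: v, w & s] x = iterD u [:: w, v & s] x.
Proof.
move=> Ux; apply: derive_comm; [|exact: (@su (w :: s))|exact: (@su (v :: s))].
near=> y; apply: (@su s); near: y; exact: open_nbhs_nbhs.
Unshelve. all: by end_near. Qed.

Lemma iterD_swap2 s z v w x : U x ->
  iterD u [:: z, v, w & s] x = iterD u [:: z, w, v & s] x.
Proof.
by move=> Ux; apply: (@iterD_derive _ _ _ _ _ Ux) => y Uy; exact: (@iterD_swap s v w y Uy).
Qed.

Lemma iterD_lin s v w a x : U x ->
  iterD u ((a *: v + w) :: s) x = a * iterD u (v :: s) x + iterD u (w :: s) x.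
Proof. by move=> Ux; exact: (derive_linear v w a (@su s x Ux)). Qed.

Lemma iterD0 s x : U x -> iterD u (0 :: s) x = 0.
Proof. by move=> Ux; rewrite /= derive0. Qed.

Lemma jet2_iterD s x z : U x ->
  jet2 (fun t => iterD u s (x + t *: z)) (iterD u s x) (iterD u (z :: s) x)
    (iterD u [:: z, z & s] x).
Proof.
move=> Ux; have E (g : 'rV[R]_n -> R) : g x = g (x + 0 *: z) by rewrite scale0r addr0.
have dz : differentiable (iterD u (z :: s)) (x + 0 *: z) by apply: su; rewrite scale0r addr0.
have d0 := is_derive_line (t := 0) (z := z) dz.
have near_line : \forall t \near (0 : R),
    is_derive (t : R) (1 : R) (fun t => iterD u s (x + t *: z)) (iterD u (z :: s) (x + t *: z)).
  near=> t; apply: is_derive_line; apply: (@su s); near: t.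
  have : x + t *: z @[t --> (0 : R)] --> x + 0 *: z.
    by apply: cvgD; [exact: cvg_cst|apply: cvgZr_tmp; exact: cvg_id].
  by rewrite scale0r addr0; apply; exact: open_nbhs_nbhs.
have := jet2_derive near_line (@ex_derive _ _ _ _ _ _ _ d0).
by rewrite (@derive_val _ _ _ _ _ _ _ d0) scale0r addr0.
Unshelve. all: by end_near. Qed.

End IterD.

(** * Linear upper bounds for the curvature function *)

Section Weights.
Variables (R : realType) (n : nat).
Implicit Types (v l m : 'rV[R]_n).

Lemma row_ebas v : v = \sum_i v ord0 i *: ebas R i.
Proof.
rewrite [LHS]row_sum_delta; apply: eq_bigr => i _; congr (_ *: _).
by apply/rowP => j; rewrite !mxE eqxx /=; case: (j == i).
Qed.

Lemma derive_ebas (g : 'rV[R]_n -> R) x v : differentiable g x ->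
  'D_v g x = \sum_i v ord0 i * 'D_(ebas R i) g x.
Proof.
move=> dg; rewrite deriveE // {1}(row_ebas v) linear_sum; apply: eq_bigr => i _.
by rewrite linearZ -deriveE.
Qed.

Lemma derive_le (g : 'rV[R]_n -> R) x v b : differentiable g x ->
  (forall t, 0 < t < 1 -> g x + t * b <= g (x + t *: v)) -> b <= 'D_v g x.
Proof.
move=> dg h; apply/ler_addgt0Pr => e e0.
have e1 : 0 < e / (`|v| + 1) by rewrite divr_gt0 // ltr_wpDl.
have [d d0 hd] := diff_approx dg e1.
pose t := Num.min (1 / 2) (d / (`|v| + 1) / 2).
have t0 : 0 < t by rewrite lt_min !divr_gt0 // ltr_wpDl.
have t1 : t <= 1 / 2 by rewrite ge_min lexx.
have td : t * (`|v| + 1) < d.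
  have : t <= d / (`|v| + 1) / 2 by rewrite ge_min lexx orbT.
  have v1 : 0 < `|v| + 1 by rewrite ltr_wpDl.
  move=> /(ler_wpM2r (ltW v1)); rewrite mulrAC divfK ?gt_eqF // => h1.
  by apply: (le_lt_trans h1); lra.
have tv : `|t *: v| <= t * (`|v| + 1).
  by rewrite normrZ gtr0_norm // ler_pM2l //; lra.
have := hd (t *: v) (le_lt_trans tv td); rewrite linearZ -deriveE // ler_norml => /andP [_ hu].
have := h t; rewrite t0 => /(_ _) hl.
have {}hl : g x + t * b <= g (x + t *: v) by apply: hl; lra.
have hb : e / (`|v| + 1) * `|t *: v| <= e * t.
  apply: le_trans (ler_wpM2l (ltW e1) tv) _.
  by rewrite mulrCA divfK ?gt_eqF ?ltr_wpDl // mulrC.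
rewrite -(ler_pM2l t0); rewrite /= in hu.
have tD : t *: 'D_v g x = t * 'D_v g x by [].
by rewrite ?tD in hu; rewrite mulrDr (mulrC t e); lra.
Qed.

(* c is the gradient of f at l: concavity gives the affine tangent bound, and
   Euler's relation makes it linear. *)
Lemma structure_weights (f : 'rV[R]_n -> R) l : structure_conditions f -> Kpos l ->
  exists c : 'I_n -> R, [/\ forall i, 0 < c i, \sum_i c i * l ord0 i = f l &
    forall m (s : 'S_n), Kpos m -> f m <= \sum_i c i * m ord0 (s i)].
Proof.
move=> [sf [symf [incf [concf [_ [_ [_ [homf _]]]]]]]] lK.
have df : differentiable f l by exact: (sf [::]).
pose c i := 'D_(ebas R i) f l.
have cl : \sum_i c i * l ord0 i = f l.
  have -> : \sum_i c i * l ord0 i = 'D_l f l.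
    by rewrite derive_ebas //; apply: eq_bigr => i _; rewrite mulrC.
  (* Euler's relation, as two one-sided bounds: homogeneity along - l and along l. *)
  apply/eqP; rewrite eq_le; apply/andP; split.
    rewrite -lerN2; have -> : - 'D_l f l = 'D_(- l) f l.
      by rewrite !deriveE // linearN.
    apply: derive_le => // t t01.
    have -> : l + t *: - l = (1 - t) *: l by rewrite scalerBl scale1r scalerN.
    by rewrite homf // ?subr_gt0; [lra|case/andP: t01].
  apply: derive_le => // t /andP [t0 t1].
  have -> : l + t *: l = (1 + t) *: l by rewrite scalerDl scale1r.
  by rewrite homf // ?addr_gt0 //; lra.
have fm m : Kpos m -> f m <= \sum_i c i * m ord0 i.
  move=> mK; have h : f m - f l <= 'D_(m - l) f l.
    apply: derive_le => // t /andP [t0 t1].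
    have -> : l + t *: (m - l) = t *: m + (1 - t) *: l.
      by rewrite scalerBr scalerBl scale1r addrCA.
    by apply: le_trans (concf _ _ _ mK lK _); [lra|rewrite !ltW].
  have E : 'D_(m - l) f l = \sum_i c i * m ord0 i - \sum_i c i * l ord0 i.
    rewrite derive_ebas // -sumrB; apply: eq_bigr => i _.
    by rewrite !mxE mulrBl /c !(mulrC ('D_(ebas R i) f l)).
  by rewrite E cl in h; lra.
exists c; split => // [i|m s mK]; first exact: incf.
rewrite -(symf s m mK); have smK : Kpos (\row_i m ord0 (s i)) by move=> i; rewrite mxE; exact: mK.
by apply: (le_trans (fm _ smK)); apply: ler_sum => i _; rewrite mxE.
Qed.

End Weights.

(** * Expansions along lines *)

Lemma jet2_near (R : realType) (phi psi : R -> R) c0 c1 c2 : jet2 phi c0 c1 c2 ->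
  (\forall t \near 0, phi t = psi t) -> jet2 psi c0 c1 c2.
Proof.
move=> [r r0 hr] h; have e0 := nbhs_singleton h.
exists (fun t => if phi t == psi t then r t else
  (psi t - (c0 + c1 * t + c2 / 2 * t ^+ 2)) / t ^+ 2) => [|t].
  apply: cvg_trans r0; apply: near_eq_cvg; apply: filterS h => t ->.
  by rewrite eqxx.
case: eqVneq => [<-|ne]; first exact: hr.
have t0 : t != 0 by apply: contra ne => /eqP ->; rewrite e0.
by rewrite divfK ?expf_neq0 //; ring.
Qed.

(* The interface through which iterated directional derivatives are used below;
   it shields iterD from unification. *)
Record calculus (R : realType) n (U : set 'rV[R]_n) (D : seq 'rV[R]_n -> 'rV[R]_n -> R) : Prop :=
  Calculus {
    calc_open : open U;
    calc_lin : forall s v w a x, U x -> D ((a *: v + w) :: s) x = a * D (v :: s) x + D (w :: s) x;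
    calc_zero : forall s x, U x -> D (0 :: s) x = 0;
    calc_swap : forall s v w x, U x -> D [:: v, w & s] x = D [:: w, v & s] x;
    calc_swap2 : forall s z v w x, U x -> D [:: z, v, w & s] x = D [:: z, w, v & s] x;
    calc_swap3 : forall s y z v w x, U x -> D [:: y, z, v, w & s] x = D [:: y, z, w, v & s] x;
    calc_jet : forall s x z, U x ->
      jet2 (fun t => D s (x + t *: z)) (D s x) (D (z :: s) x) (D [:: z, z & s] x)
  }.

Lemma iterD_calculus (R : realType) n (U : set 'rV[R]_n) u :
  open U -> smooth_on U u -> calculus U (iterD u).
Proof.
move=> oU su; split.
- exact: oU.
- exact: iterD_lin su.
- exact: iterD0.
- exact: iterD_swap.
- exact: iterD_swap2.
- move=> s y z v w x Ux; apply: (iterD_derive oU _ _ Ux) => t Ut.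
  exact: (iterD_swap2 oU su s z v w Ut).
- exact: jet2_iterD.
Qed.

Section Calculus.
Variables (R : realType) (n : nat) (U : set 'rV[R]_n) (D : seq 'rV[R]_n -> 'rV[R]_n -> R).
Hypothesis cD : calculus U D.
Implicit Types (x v w z A C : 'rV[R]_n).

Let Dlin s v w a x (Ux : U x) := calc_lin cD s v w a Ux.
Let Dswap s v w x (Ux : U x) := calc_swap cD s v w Ux.

Lemma D_scale s v a x : U x -> D ((a *: v) :: s) x = a * D (v :: s) x.
Proof. by move=> Ux; rewrite -[a *: v]addr0 Dlin // (calc_zero cD) // addr0. Qed.

Lemma D_scale2 s z v a x : U x -> D [:: z, a *: v & s] x = a * D [:: z, v & s] x.
Proof. by move=> Ux; rewrite (Dswap s z (a *: v)) // D_scale // (Dswap _ v). Qed.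

Lemma D_add s v w x : U x -> D ((v + w) :: s) x = D (v :: s) x + D (w :: s) x.
Proof. by move=> Ux; rewrite -{1}[v]scale1r Dlin // mul1r. Qed.

Lemma D_add2 s z v w x : U x -> D [:: z, v + w & s] x = D [:: z, v & s] x + D [:: z, w & s] x.
Proof. by move=> Ux; rewrite (Dswap s z (v + w)) // D_add // !(Dswap _ _ z). Qed.

Lemma D_sum (I : finType) (P : pred I) s (c : I -> R) (v : I -> 'rV[R]_n) x : U x ->
  D ((\sum_(i | P i) c i *: v i) :: s) x = \sum_(i | P i) c i * D (v i :: s) x.
Proof.
move=> Ux; elim: (index_enum I) => [|i r IH]; first by rewrite !big_nil (calc_zero cD).
by rewrite !big_cons; case: ifP => // _; rewrite Dlin // IH.
Qed.

Lemma line_near x z : U x -> \forall t \near (0 : R), U (x + t *: z).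
Proof.
move=> Ux; have : x + t *: z @[t --> (0 : R)] --> x + 0 *: z.
  by apply: cvgD; [exact: cvg_cst|apply: cvgZr_tmp; exact: cvg_id].
by rewrite scale0r addr0; apply; apply: open_nbhs_nbhs; split => //; exact: calc_open cD.
Qed.

(** [A] prescribes how the vector turns; [C] is left free to correct lengths and angles at second
    order. *)
Definition curve v A C (t : R) : 'rV[R]_n := v + (t *: A + (t ^+ 2 / 2) *: C).

Lemma jet2_curve1 x z v A C : U x ->
  jet2 (fun t => D [:: curve v A C t] (x + t *: z)) (D [:: v] x)
    (D [:: z; v] x + D [:: A] x)
    (D [:: z; z; v] x + 2 * D [:: z; A] x + D [:: C] x).
Proof.
move=> Ux; have j s := calc_jet cD s z Ux.
have jt := jet2_id R.
have J := jet2D (j [:: v]) (jet2D (jet2M jt (j [:: A])) (jet2M (jet2M jt jt) (jet2Z 2^-1 (j [:: C])))).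
apply: (jet2_near (jet2_eq J (fun=> erefl) _ _ _)); [ring|ring|by field|].
apply: filterS (line_near z Ux) => t Ut.
by rewrite /curve D_add // D_add // !D_scale //; field.
Qed.

Lemma jet2_curve2 x z v A C : U x ->
  jet2 (fun t => D [:: curve v A C t; curve v A C t] (x + t *: z)) (D [:: v; v] x)
    (D [:: z; v; v] x + 2 * D [:: v; A] x)
    (D [:: z; z; v; v] x + 4 * D [:: z; v; A] x + 2 * D [:: A; A] x
       + 2 * D [:: v; C] x).
Proof.
move=> Ux; have j s := calc_jet cD s z Ux.
have jt := jet2_id R.
have J := jet2D (j [:: v; v]) (jet2D (jet2M jt (jet2Z 2 (j [:: v; A]))) (jet2M (jet2M jt jt)
    (jet2D (jet2D (j [:: A; A]) (j [:: v; C]))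
     (jet2M jt (jet2D (j [:: A; C]) (jet2M jt (jet2Z 4^-1 (j [:: C; C])))))))).
apply: (jet2_near (jet2_eq J (fun=> erefl) _ _ _)); [ring|ring|ring|].
apply: filterS (line_near z Ux) => t Ut.
rewrite /curve !(D_add _ _ _ Ut) !(D_scale _ _ _ Ut) !(D_add2 _ _ _ _ Ut) !(D_scale2 _ _ _ _ Ut).
by rewrite (Dswap _ A v) // (Dswap _ C v) // (Dswap _ C A) //; field.
Qed.

Definition gradD x : 'rV[R]_n := \row_i D [:: ebas R i] x.

Lemma D1E x v : U x -> D [:: v] x = dotv (gradD x) v.
Proof.
by move=> Ux; rewrite {1}(row_ebas v) D_sum //; apply: eq_bigr => i _; rewrite mulrC mxE.
Qed.

Definition wD x : R := Num.sqrt (1 + dotv (gradD x) (gradD x)).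

Lemma wD_arg_gt0 x : 0 < 1 + dotv (gradD x) (gradD x).
Proof. by rewrite ltr_wpDr ?dotv_ge0. Qed.

Lemma wD_gt0 x : 0 < wD x.
Proof. by rewrite sqrtr_gt0 wD_arg_gt0. Qed.

Lemma wD_sqr x : wD x ^+ 2 = 1 + dotv (gradD x) (gradD x).
Proof. by rewrite sqr_sqrtr // ltW // wD_arg_gt0. Qed.

Definition hessrow x z : 'rV[R]_n := \row_i D [:: z; ebas R i] x.

Lemma hessrowE x z v : U x -> dotv (hessrow x z) v = D [:: z; v] x.
Proof.
move=> Ux; rewrite Dswap // {2}(row_ebas v) D_sum //; apply: eq_bigr => i _.
by rewrite mxE Dswap // mulrC.
Qed.

Lemma jet2_wD x z : U x -> let w1 := D [:: z; gradD x] x / wD x in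
  jet2 (fun t => wD (x + t *: z)) (wD x) w1
    ((dotv (hessrow x z) (hessrow x z) + D [:: z; z; gradD x] x - w1 ^+ 2) / wD x).
Proof.
move=> Ux w1; have w0 := wD_gt0 x.
have J : jet2 (fun t => 1 + dotv (gradD (x + t *: z)) (gradD (x + t *: z)))
    (1 + dotv (gradD x) (gradD x)) (2 * D [:: z; gradD x] x)
    (2 * (dotv (hessrow x z) (hessrow x z) + D [:: z; z; gradD x] x)).
  have js k := jet2M (calc_jet cD [:: ebas R k] z Ux) (calc_jet cD [:: ebas R k] z Ux).
  have := jet2D (jet2_cst 1) (jet2_sum (P := xpredT) (fun k _ => js k)).
  move/jet2_eq; apply.
  - by move=> t; congr (_ + _); apply: eq_bigr => k _; rewrite !mxE.
  - by congr (_ + _); apply: eq_bigr => k _; rewrite !mxE.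
  - rewrite add0r Dswap // {1}(row_ebas (gradD x)) D_sum // big_distrr.
    by apply: eq_bigr => k _; rewrite mxE (Dswap _ z) //=; ring.
  rewrite add0r (calc_swap2 cD [::] z z (gradD x)) // (Dswap [:: z] z (gradD x)) //.
  rewrite {1}(row_ebas (gradD x)) D_sum // mulrDr /dotv !big_distrr -big_split /=.
  apply: eq_bigr => k _; rewrite !mxE (Dswap [:: z] (ebas R k) z) // (calc_swap2 cD [::] z (ebas R k) z) //=; ring.
apply: jet2_eq (jet2_sqrt (fun t => wD_arg_gt0 (x + t *: z)) w0 (esym (wD_sqr x)) J) _ _ _ _ => //.
- by rewrite /w1; field; rewrite gt_eqF.
- by rewrite /w1; field; rewrite gt_eqF.
Qed.

(** The first fundamental form of the graph for the Euclidean metric, in base coordinates; the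
    induced hyperbolic metric is this one divided by u^2. *)
Definition gmet x v w : R := dotv v w + D [:: v] x * D [:: w] x.

End Calculus.

(** * Second-order conditions at a maximum *)

Section Metric.
Variables (R : realType) (n : nat) (U : set 'rV[R]_n) (D : seq 'rV[R]_n -> 'rV[R]_n -> R).
Hypothesis cD : calculus U D.
Implicit Types (x v w z A C : 'rV[R]_n).

Lemma gmetC x v w : gmet D x v w = gmet D x w v.
Proof. by rewrite /gmet dotvC mulrC. Qed.

Lemma gmetDl x v v' w : U x -> gmet D x (v + v') w = gmet D x v w + gmet D x v' w.
Proof. by move=> Ux; rewrite /gmet dotvDl (D_add cD) //; ring. Qed.

Lemma gmetZl x a v w : U x -> gmet D x (a *: v) w = a * gmet D x v w.
Proof. by move=> Ux; rewrite /gmet dotvZl (D_scale cD) //; ring. Qed.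

Lemma gmetDr x v v' w : U x -> gmet D x w (v + v') = gmet D x w v + gmet D x w v'.
Proof. by move=> Ux; rewrite !(gmetC x w) gmetDl. Qed.

Lemma gmetZr x a v w : U x -> gmet D x w (a *: v) = a * gmet D x w v.
Proof. by move=> Ux; rewrite !(gmetC x w) gmetZl. Qed.

Lemma gmet_suml x (I : finType) (P : pred I) (c : I -> R) (e : I -> 'rV[R]_n) w : U x ->
  gmet D x (\sum_(i | P i) c i *: e i) w = \sum_(i | P i) c i * gmet D x (e i) w.
Proof.
move=> Ux; elim: (index_enum I) => [|i r IH].
  by rewrite !big_nil -(scale0r 0) gmetZl // mul0r.
by rewrite !big_cons; case: ifP => // _; rewrite gmetDl // gmetZl // IH.
Qed.

Lemma near_along x z (P : set 'rV[R]_n) : (\forall y \near x, P y) ->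
  \forall t \near (0 : R), P (x + t *: z).
Proof.
move=> h; have : x + t *: z @[t --> (0 : R)] --> x + 0 *: z.
  by apply: cvgD; [exact: cvg_cst|apply: cvgZr_tmp; exact: cvg_id].
by rewrite scale0r addr0; apply.
Qed.

Lemma jet2_dot_curve v A C v' A' C' :
  jet2 (fun t => dotv (curve v A C t) (curve v' A' C' t)) (dotv v v')
   (dotv v A' + dotv A v') (dotv v C' + 2 * dotv A A' + dotv C v').
Proof.
have jt := jet2_id R.
have J := jet2D (jet2_cst (dotv v v')) (jet2M jt (jet2D (jet2_cst (dotv v A' + dotv A v'))
  (jet2M jt (jet2D (jet2_cst ((dotv v C' + 2 * dotv A A' + dotv C v') / 2))
   (jet2M jt (jet2D (jet2_cst ((dotv A C' + dotv C A') / 2)) (jet2M jt (jet2_cst (dotv C C' / 4))))))))).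
apply: (jet2_eq J) => [t|||]; [|ring|ring|by field].
by rewrite /curve !(dotvDl, dotvDr, dotvZl, dotvZr); field.
Qed.

Lemma jet2_gmet x z v A C v' A' C' : U x ->
  let q := D [:: z; v] x + D [:: A] x in let q' := D [:: z; v'] x + D [:: A'] x in
  let r := D [:: z; z; v] x + 2 * D [:: z; A] x + D [:: C] x in
  let r' := D [:: z; z; v'] x + 2 * D [:: z; A'] x + D [:: C'] x in
  jet2 (fun t => gmet D (x + t *: z) (curve v A C t) (curve v' A' C' t)) (gmet D x v v')
   (dotv v A' + dotv A v' + (D [:: v] x * q' + q * D [:: v'] x))
   (dotv v C' + 2 * dotv A A' + dotv C v' + (D [:: v] x * r' + 2 * q * q' + r * D [:: v'] x)).
Proof.
move=> Ux q q' r r'.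
exact: (jet2D (jet2_dot_curve v A C v' A' C') (jet2M (jet2_curve1 cD z v A C Ux) (jet2_curve1 cD z v' A' C' Ux))).
Qed.

End Metric.

Section Core.
Variables (R : realType) (n : nat) (U : set 'rV[R]_n) (D : seq 'rV[R]_n -> 'rV[R]_n -> R).
Hypothesis cD : calculus U D.
Variables (x0 : 'rV[R]_n) (Ux0 : U x0).
Implicit Types (v z A C xi : 'rV[R]_n).

Section Directions.
Variables (M0 a : R).

(** This is w (B(xi, xi) - M0 (nu - a) g(xi, xi)), where w B = g + u D^2 u. *)
Let H x xi := (1 - M0 + M0 * a * wD D x) * gmet D x xi xi + D [::] x * D [:: xi; xi] x.

(** [H] is quadratic in xi, hence nonpositive on vectors of any length. The moving vector v + t A
    therefore needs no normalization, and the correction [C] is taken to be 0. *)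
Lemma max_direction z v A (w1 w2 : R) :
  (\forall x \near x0, forall xi, H x xi <= 0) -> H x0 v = 0 -> gmet D x0 v v = 1 ->
  jet2 (fun t => wD D (x0 + t *: z)) (wD D x0) w1 w2 ->
  let al := 1 - M0 + M0 * a * wD D x0 in
  let q := D [:: z; v] x0 + D [:: A] x0 in
  let g1 := 2 * (dotv v A + D [:: v] x0 * q) in
  let g2 := 2 * (dotv A A + q ^+ 2 + D [:: v] x0 * (D [:: z; z; v] x0 + 2 * D [:: z; A] x0)) in
  let h1 := D [:: z; v; v] x0 + 2 * D [:: v; A] x0 in
  M0 * a * w1 + al * g1 + D [:: z] x0 * D [:: v; v] x0 + D [::] x0 * h1 = 0 /\
  M0 * a * w2 + 2 * (M0 * a * w1) * g1 + al * g2 + D [:: z; z] x0 * D [:: v; v] x0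
   + 2 * D [:: z] x0 * h1 + D [::] x0 * (D [:: z; z; v; v] x0 + 4 * D [:: z; v; A] x0 + 2 * D [:: A; A] x0) <= 0.
Proof.
move=> hM H0 g0 jw al q g1 g2 h1.
have J1 := jet2M (jet2D (jet2_cst (1 - M0)) (jet2Z (M0 * a) jw)) (jet2_gmet cD z v A 0 v A 0 Ux0).
have J := jet2D J1 (jet2M (calc_jet cD [::] z Ux0) (jet2_curve2 cD z v A 0 Ux0)).
have D0 s : D (0 :: s) x0 = 0 by exact: calc_zero cD s x0 Ux0.
have D02 : D [:: v; 0] x0 = 0 by rewrite (calc_swap cD).
have d0 (y : 'rV[R]_n) : dotv y 0 = 0 by apply: big1 => k _; rewrite mxE mulr0.
have [|e e0|] := jet2_min (jet2Z (-1) J).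
- by rewrite -[RHS](mulr0 (-1)) -H0 /H /gmet.
- apply: filterS (near_along z hM) => t /(_ (curve v A 0 t)).
  by rewrite /H mulN1r => h; have := sqr_ge0 t; nra.
rewrite g0 D0 D02 !(dotvC 0) !d0 => e1 e2; split.
  apply: oppr_inj; rewrite oppr0 -e1 /al /g1 /q /h1 (dotvC A v).
  by ring.
rewrite -oppr_ge0; move: e2; rewrite /g1 /g2 /q /h1 (dotvC A v).
congr (_ <= _); rewrite /al.
by ring.
Qed.

End Directions.

Lemma jet2_flat (phi : R -> R) c0 : jet2 phi c0 0 0 ->
  forall e, 0 < e -> \forall t \near (0 : R), `|phi t - c0| <= e * t ^+ 2.
Proof.
move=> [r r0 hr] e e0; have /cvgr0_norm_le/(_ e e0) := r0; apply: filterS => t rt.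
have -> : phi t - c0 = r t * t ^+ 2 by rewrite hr; ring.
rewrite normrM.
by rewrite [X in _ * X]ger0_norm ?sqr_ge0 // ler_wpM2r ?sqr_ge0.
Qed.

Section Frame.
Variables (i1 : 'I_n) (E : 'I_n -> 'rV[R]_n) (b c : 'I_n -> R) (K0 L C0 : R).

(** For K0 = c_1 M and L = c_1 M a + sigma this is w (sum_i c_i B(P_i, P_i) - sigma) on orthonormal
    frames, with B(P_1, P_1) replaced by its upper bound M (nu - a). *)
Definition frame_fun x (P : 'I_n -> 'rV[R]_n) : R :=
  \sum_(i | i != i1) c i * (1 + D [::] x * D [:: P i; P i] x) + K0 - L * wD D x.

Hypothesis E_orth : forall i j, gmet D x0 (E i) (E j) = (i == j)%:R.
Hypothesis E_hess : forall i v, D [:: E i; v] x0 = wD D x0 * b i * gmet D x0 (E i) v.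
Hypothesis C0_ge0 : 0 <= C0.
Hypothesis frame_min : \forall x \near x0, forall eps P, 0 <= eps <= 1 ->
  (forall i j, `|gmet D x (P i) (P j) - (i == j)%:R| <= eps) -> - (C0 * eps) <= frame_fun x P.
Hypothesis frame_eq : frame_fun x0 E = 0.

(** [A] need only preserve the Gram matrix at first order. The vectors [C] then remove the
    second-order defect, and the o(t^2) that remains is absorbed by the tolerance [eps] in
    [frame_min]. *)
Lemma frame_direction z (A : 'I_n -> 'rV[R]_n) (w1 w2 : R) :
  jet2 (fun t => wD D (x0 + t *: z)) (wD D x0) w1 w2 ->
  let q i := D [:: z; E i] x0 + D [:: A i] x0 in
  (forall i j, dotv (E i) (A j) + dotv (A i) (E j) +
     (D [:: E i] x0 * q j + q i * D [:: E j] x0) = 0) ->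
  let h i := D [:: z; E i; E i] x0 + 2 * D [:: E i; A i] x0 in
  let Z i := 2 * (dotv (A i) (A i) + q i ^+ 2 +
    D [:: E i] x0 * (D [:: z; z; E i] x0 + 2 * D [:: z; A i] x0)) in
  \sum_(i | i != i1) c i * (D [:: z] x0 * D [:: E i; E i] x0 + D [::] x0 * h i) - L * w1 = 0 /\
  0 <= \sum_(i | i != i1) c i * (D [:: z; z] x0 * D [:: E i; E i] x0 + 2 * D [:: z] x0 * h i
    + D [::] x0 * (D [:: z; z; E i; E i] x0 + 4 * D [:: z; E i; A i] x0 + 2 * D [:: A i; A i] x0
      - wD D x0 * b i * Z i)) - L * w2.
Proof.
move=> jw q gram1 h Z.
pose r i := D [:: z; z; E i] x0 + 2 * D [:: z; A i] x0.
pose Zm i j := 2 * dotv (A i) (A j) + (D [:: E i] x0 * r j + 2 * q i * q j + r i * D [:: E j] x0).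
(* [Zm] is the second derivative of the Gram matrix without correction; by symmetry each of the two
   vectors of a pair compensates half of it. *)
pose C i := \sum_j (- (Zm i j / 2)) *: E j.
have gC i k : gmet D x0 (C i) (E k) = - (Zm i k / 2).
  rewrite (gmet_suml cD) // (bigD1 k) //= big1 => [|j jk]; last first.
    by rewrite E_orth (negbTE jk) mulr0.
  by rewrite E_orth eqxx mulr1 addr0.
have ZmC i j : Zm i j = Zm j i by rewrite /Zm (dotvC (A j)); ring.
have gram2 i j : dotv (E i) (C j) + 2 * dotv (A i) (A j) + dotv (C i) (E j) +
   (D [:: E i] x0 * (r j + D [:: C j] x0) + 2 * q i * q j + (r i + D [:: C i] x0) * D [:: E j] x0) = 0.
  have g1 : dotv (C i) (E j) = - (Zm i j / 2) - D [:: C i] x0 * D [:: E j] x0.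
    by rewrite -gC /gmet; ring.
  have g2 : dotv (E i) (C j) = - (Zm i j / 2) - D [:: C j] x0 * D [:: E i] x0.
    by rewrite ZmC -gC /gmet dotvC; ring.
  by rewrite g1 g2 {1 2}/Zm; field.
have gram i j : jet2 (fun t => gmet D (x0 + t *: z) (curve (E i) (A i) (C i) t) (curve (E j) (A j) (C j) t))
    (i == j)%:R 0 0.
  apply: (jet2_eq (jet2_gmet cD z (E i) (A i) (C i) (E j) (A j) (C j) Ux0) (fun=> erefl)).
  - exact: E_orth.
  - exact: gram1.
  - exact: gram2.
pose Y i := D [:: z; z; E i; E i] x0 + 4 * D [:: z; E i; A i] x0 + 2 * D [:: A i; A i] x0.
have Jh i := jet2_curve2 cD z (E i) (A i) (C i) Ux0.
have Jt i := jet2Z (c i) (jet2D (jet2_cst 1) (jet2M (calc_jet cD [::] z Ux0) (Jh i))).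
have J := jet2B (jet2D (jet2_sum (P := fun i => i != i1) (fun i _ => Jt i)) (jet2_cst K0)) (jet2Z L jw).
have [|e e0|e1 e2] := jet2_min J.
- exact: frame_eq.
- pose e' := e / (C0 + 1).
  have C1 : 0 < C0 + 1 by rewrite ltr_wpDl.
  have e'0 : 0 < e' by rewrite divr_gt0.
  have small : \forall t \near (0 : R), e' * t ^+ 2 <= 1.
    have := jet2_continuous (jet2Z e' (jet2M (jet2_id R) (jet2_id R))).
    rewrite !mulr0 => /cvgr_lt /(_ 1 ltr01); apply: filterS => t /ltW.
    by rewrite expr2.
  pose Q i j (t : R) : Prop :=
    `|gmet D (x0 + t *: z) (curve (E i) (A i) (C i) t) (curve (E j) (A j) (C j) t) - (i == j)%:R|
      <= e' * t ^+ 2.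
  have flat : \forall t \near (0 : R), forall i j, Q i j t.
    have fQ i : \forall t \near (0 : R), forall j, Q i j t.
      exact: (@filter_forall R 'I_n (Q i) (nbhs (0 : R)) _ (fun j => jet2_flat (gram i j) e'0)).
    exact: (@filter_forall R 'I_n (fun i t => forall j, Q i j t) (nbhs (0 : R)) _ fQ).
  have flm := near_along z frame_min.
  near=> t.
  have h1 : e' * t ^+ 2 <= 1 by near: t; exact: small.
  have h2 i j : `|gmet D (x0 + t *: z) (curve (E i) (A i) (C i) t) (curve (E j) (A j) (C j) t) - (i == j)%:R|
      <= e' * t ^+ 2 by move: i j; near: t; exact: flat.
  have h3 : forall eps P, 0 <= eps <= 1 ->
      (forall i j, `|gmet D (x0 + t *: z) (P i) (P j) - (i == j)%:R| <= eps) ->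
      - (C0 * eps) <= frame_fun (x0 + t *: z) P by near: t; exact: flm.
  apply: le_trans (h3 (e' * t ^+ 2) (fun i => curve (E i) (A i) (C i) t) _ h2).
  + rewrite mulNr lerN2 mulrA ler_wpM2r ?sqr_ge0 //.
    have -> : e = e' * (C0 + 1) by rewrite /e' divfK // gt_eqF.
    by rewrite mulrC ler_pM2l // lerDl.
  + by rewrite h1 andbT mulr_ge0 ?sqr_ge0 // ltW.
split.
  rewrite -[RHS]e1 addr0; congr (_ - _); apply: eq_bigr => i _; rewrite /h; ring.
move: e2; rewrite addr0; congr (_ <= _ - _); apply: eq_bigr => i _.
(* As E_i is an eigenvector of D^2 u relative to [gmet], the correction C_i enters only through its
   product with E_i, which is known. *)
have -> : D [:: E i; C i] x0 = - (wD D x0 * b i * (Z i / 2)).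
  rewrite E_hess gmetC gC /Z /Zm /r; ring.
by rewrite /h; field.
Unshelve. all: by end_near. Qed.

End Frame.
End Core.

(** * The curvature inequality *)

Section Algebra.
Variables (R : realFieldType) (n : nat) (i1 : 'I_n).
(** Values at the maximum: b_i are the Euclidean principal curvatures, p_i = D u(E_i), x_i = D^3
    u(E_i, E_1, E_1), y_i = D^3 u(E_1, E_i, E_i), tau_i = D^3 u(E_i, E_i, ps), Q_i = D^4 u(E_1, E_1,
    E_i, E_i) and B = D^2 u(ps, ps), where ps is the gradient of u for [gmet]; k_i are the turning
    rates of the frame. *)
Variables (c p b x y tau Q k : 'I_n -> R) (u w a M L tau1 B : R).

Let nu := w^-1.
Let kap i := nu + u * b i.

Definition rest_term (K1 K : R) := K * (1 + K1 ^+ 2) + a * M * (1 + K ^+ 2) - M * K * (1 + nu ^+ 2).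

(** F_i for i <> 1: a quadratic polynomial in the free rate K = u k_i, with leading coefficient 2
    (kappa_1 - kappa_i). *)
Definition tail_term i := let d := kap i1 - kap i in let m := kap i - nu in let K := u * k i in
  2 * K ^+ 2 * d + 4 * K * p i * (d + M * m) + 2 * p i ^+ 2 * (d + M * m) - rest_term (kap i1) (kap i).

Definition head_term := - (2 * p i1 ^+ 2 * M * (kap i1 - nu)) - rest_term (kap i1) (kap i1).

Hypotheses (w_gt0 : 0 < w) (u_gt0 : 0 < u).
Hypothesis eq0 : 1 - M + M * a * w = - (u * w * b i1).
Hypothesis eqL : \sum_(i | i != i1) c i * (1 + u * (w * b i)) + c i1 * M - L * w = 0.
Hypothesis max1 : M * a * (w * B) - u * w * b i1 * (2 * (p i1 * (w * b i1 * p i1)))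
  + (1 - nu ^+ 2) * (w * b i1) + u * tau1 = 0.
Hypothesis maxi : forall i, i != i1 -> M * a * (w ^+ 2 * b i * p i) + p i * (w * b i1) + u * x i = 0.
Hypothesis max2 : forall i, i != i1 -> let m := p i1 / u in
  M * a * (w * b i ^+ 2 + w * tau i) - u * w * b i1 * (2 * (m ^+ 2 + p i1 * (y i + 2 * (m * (w * b i)))))
  + w * b i * (w * b i1) + 2 * p i * x i + u * (Q i + 4 * (m * y i) + 2 * (m ^+ 2 * (w * b i))) <= 0.
Hypothesis frame1 : \sum_(i | i != i1) c i * ((1 - nu ^+ 2) * (w * b i) + u * (tau i - 2 * (w * b i * p i) ^+ 2))
  - L * (w * B) = 0.
Hypothesis frame11 : \sum_(i | i != i1) c i * (p i1 * (w * b i) + u * y i) - L * (w ^+ 2 * b i1 * p i1) = 0.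
Hypothesis frame2 : 0 <= \sum_(i | i != i1) c i * (w * b i1 * (w * b i) + 2 * p i1 * y i
    + u * (Q i - 4 * (k i * x i) + 2 * (k i ^+ 2 * (w * b i1))
      - w * b i * (2 * (k i ^+ 2 + p i * (x i - 2 * (k i * (w * b i1)))))))
  - L * (w * b i1 ^+ 2 + w * tau1).
Hypothesis c_ge0 : forall i, 0 <= c i.

(* u^2 / w times: frame2 minus the weighted sum of max2, with the remaining
   third derivatives eliminated through frame1, frame11, max1 and maxi. *)
Lemma combined_inequality : 0 <= \sum_(i | i != i1) c i * tail_term i + c i1 * head_term.
Proof.
have un : u != 0 by rewrite gt_eqF.
have wn : w != 0 by rewrite gt_eqF.
set Y := fun i => (M * a * (w * b i ^+ 2 + w * tau i)
  - u * w * b i1 * (2 * ((p i1 / u) ^+ 2 + p i1 * (y i + 2 * (p i1 / u * (w * b i)))))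
  + w * b i * (w * b i1) + 2 * p i * x i + u * (Q i + 4 * (p i1 / u * y i) + 2 * ((p i1 / u) ^+ 2 * (w * b i)))).
have hY : \sum_(i | i != i1) c i * Y i <= 0.
  by apply: sumr_le0 => i ii; rewrite mulr_ge0_le0 //; exact: max2.
pose X i := c i * (w * b i1 * (w * b i) + 2 * p i1 * y i
    + u * (Q i - 4 * (k i * x i) + 2 * (k i ^+ 2 * (w * b i1))
      - w * b i * (2 * (k i ^+ 2 + p i * (x i - 2 * (k i * (w * b i1))))))).
have f2 : 0 <= \sum_(i | i != i1) X i - L * (w * b i1 ^+ 2 + w * tau1) := frame2.
(* Multipliers of [frame11] and [frame1] that cancel the y_i and the tau_i left in X - c Y; the Q_i
   cancel by themselves. *)
pose l1 := 2 * p i1 * (u * w * b i1 - 1) / u.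
pose l2 := M * a * w / u.
have Ma : M * a = (M - 1 - u * w * b i1) / w.
  by apply: (mulIf wn); rewrite divfK //; move: eq0; lra.
have t1 : tau1 = - (M * a * (w * B) - u * w * b i1 * (2 * (p i1 * (w * b i1 * p i1)))
  + (1 - nu ^+ 2) * (w * b i1)) / u.
  by apply: (mulIf un); rewrite divfK //; move: max1; lra.
have xE i : i != i1 -> x i = - (M * a * (w ^+ 2 * b i * p i) + p i * (w * b i1)) / u.
  by move=> ii; apply: (mulIf un); rewrite divfK //; have := maxi ii; lra.
pose s1 i := c i * (p i1 * (w * b i) + u * y i).
pose S1 := \sum_(i | i != i1) s1 i.
pose s2 i := c i * ((1 - nu ^+ 2) * (w * b i) + u * (tau i - 2 * (w * b i * p i) ^+ 2)).
pose S2 := \sum_(i | i != i1) s2 i.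
pose W i := c i * (1 + u * (w * b i)).
(* Once L w is spread over the weights c_i, the identity [main] can be checked index by index. *)
have LE : L = (\sum_(i | i != i1) W i + c i1 * M) / w.
  by apply: (mulIf wn); rewrite divfK //; move: eqL; lra.
have main : \sum_(i | i != i1) c i * tail_term i + c i1 * head_term =
  u ^+ 2 / w * ((\sum_(i | i != i1) X i - L * (w * b i1 ^+ 2 + w * tau1)) - \sum_(i | i != i1) c i * Y i
   - l1 * (S1 - L * (w ^+ 2 * b i1 * p i1)) + l2 * (S2 - L * (w * B))).
  pose T := - (w * b i1 ^+ 2 + w * tau1) + l1 * (w ^+ 2 * b i1 * p i1) - l2 * (w * B).
  have -> : \sum_(i | i != i1) X i - L * (w * b i1 ^+ 2 + w * tau1) - \sum_(i | i != i1) c i * Y i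
   - l1 * (S1 - L * (w ^+ 2 * b i1 * p i1)) + l2 * (S2 - L * (w * B)) =
   \sum_(i | i != i1) X i - \sum_(i | i != i1) c i * Y i - l1 * S1 + l2 * S2 + L * T.
    by rewrite /T; ring.
  have -> : \sum_(i | i != i1) X i - \sum_(i | i != i1) c i * Y i - l1 * S1 + l2 * S2 + L * T =
    \sum_(i | i != i1) (X i - c i * Y i - l1 * s1 i + l2 * s2 i + W i * (T / w)) + c i1 * M * (T / w).
    rewrite !big_split /= !sumrN -!big_distrr -big_distrl /= LE /S1 /S2; by field.
  rewrite [in RHS]mulrDr [in RHS]big_distrr /=; congr (_ + _).
    apply: eq_bigr => i ii.
    rewrite /X /Y /W /s1 /s2 /T xE // t1 /l1 /l2 Ma /tail_term /rest_term (mulrC a) Ma /kap /nu.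
    by field; rewrite un wn.
  rewrite /T t1 /l1 /l2 Ma /head_term /rest_term (mulrC a) Ma /kap /nu.
  by field; rewrite un wn.
have E1 : S1 - L * (w ^+ 2 * b i1 * p i1) = 0 := frame11.
have E2 : S2 - L * (w * B) = 0 := frame1.
rewrite main E1 E2 !mulr0 subr0 addr0 mulr_ge0 //; last lra.
by rewrite divr_ge0 ?sqr_ge0 // ltW.
Qed.

End Algebra.

(** * Negativity of the F_i *)

Section Sign.
Variables (R : realFieldType) (n : nat) (i1 : 'I_n).
Variables (p b : 'I_n -> R) (u w a M : R).
Let nu := w^-1.
Let kap i := nu + u * b i.

Hypotheses (a_gt0 : 0 < a) (nu_ge : 2 * a <= nu) (nu_le1 : nu <= 1) (u_gt0 : 0 < u).
Hypothesis M_gt : 4 / a ^+ 3 < M.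
Hypothesis kap_max : kap i1 = M * (nu - a).
Hypothesis kap_gt0 : forall i, 0 < kap i.
Hypothesis kap_le : forall i, kap i <= kap i1.
Hypothesis p_le1 : forall i, p i ^+ 2 <= 1.

(* For kappa_i > a the choice -p_i amounts to differentiating along the
   hyperbolic parallel frame; otherwise k_i minimizes the quadratic tail_term. *)
Definition rotation i : R := - p i / u *
  (if kap i <= a then 1 + M * (kap i - nu) / (kap i1 - kap i) else 1).

Let a3 : 4 < M * a ^+ 3.
Proof. by rewrite -ltr_pdivrMr ?exprn_gt0. Qed.

Let M_gt0 : 0 < M.
Proof. by apply: le_lt_trans M_gt; rewrite divr_ge0 // exprn_ge0 // ltW. Qed.

Let a_le : a <= 1 / 2. Proof. by move: nu_ge nu_le1; lra. Qed.

Let k1_ge : M * a <= kap i1.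
Proof. by rewrite kap_max ler_pM2l //; move: nu_ge; lra. Qed.

Let Ma : 4 <= M * a ^+ 2.
Proof.
have : M * a ^+ 3 <= M * a ^+ 2.
  rewrite ler_pM2l // exprS -[leRHS]mul1r ler_wpM2r ?sqr_ge0 //; move: a_le; lra.
by move: a3; lra.
Qed.

Let k1_gt1 : 1 < kap i1.
Proof.
apply: lt_le_trans k1_ge; have : M * a ^+ 2 <= M * a.
  by rewrite ler_pM2l // expr2 -[leRHS]mul1r ler_wpM2r ?ltW //; move: a_le; lra.
by move: Ma; lra.
Qed.

(** The threshold 4 / a^3 acts here: kappa_1^2 >= M^2 a^2 = (M / a) (M a^3). *)
Let k1_sqr : 2 * M / a <= kap i1 ^+ 2.
Proof.
have Ma0 : 0 <= M * a by rewrite mulr_ge0 ?ltW.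
apply: (@le_trans _ _ ((M * a) ^+ 2)); last first.
  by rewrite ler_sqr ?nnegrE // (le_trans Ma0).
rewrite ler_pdivrMr //; have -> : (M * a) ^+ 2 * a = M * (M * a ^+ 3) by ring.
by rewrite mulrC ler_pM2l //; move: a3; lra.
Qed.

(** The bound on [q] is the room left in kappa_1^2 >= 2 M / a once M (1 + nu^2) <= 2 M has been
    paid. *)
Lemma rest_term_gt i q : 0 <= q -> q <= 2 * M * (a^-1 - 1) -> q * kap i < rest_term w a M (kap i1) (kap i).
Proof.
move=> q0 q1; rewrite /rest_term -/nu.
have aM : 0 < a * M * (1 + kap i ^+ 2) by rewrite !mulr_gt0 // ltr_wpDr // sqr_ge0.
have nu2 : nu ^+ 2 <= 1 by rewrite expr_le1 //; move: nu_ge a_gt0; lra.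
have h1 : M * (1 + nu ^+ 2) + q <= 2 * M / a.
  have : M * (1 + nu ^+ 2) <= M * 2 by rewrite ler_pM2l //; lra.
  by move: q1; lra.
have h2 : kap i * (M * (1 + nu ^+ 2) + q) <= kap i * (1 + kap i1 ^+ 2).
  by rewrite ler_pM2l //; move: k1_sqr; lra.
lra.
Qed.

Let ainv : 2 <= a^-1.
Proof. by rewrite -[2]invrK lef_pV2 ?posrE ?invr_gt0 //; move: a_le; lra. Qed.

Lemma head_term_lt0 : head_term i1 p b u w a M < 0.
Proof.
rewrite /head_term -/nu -/(kap i1).
have q0 : 0 <= 2 * M * (a^-1 - 1) by rewrite !mulr_ge0 ?ltW //; move: ainv; lra.
have := rest_term_gt i1 (lexx 0) q0; rewrite mul0r => h.
have : 0 <= p i1 ^+ 2 * (M * (kap i1 - nu)).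
  by rewrite mulr_ge0 ?sqr_ge0 // mulr_ge0 ?(ltW M_gt0) //; move: k1_gt1 nu_le1; lra.
lra.
Qed.

Lemma tail_term_lt0 i : tail_term i1 p b rotation u w a M i < 0.
Proof.
have un : u != 0 by rewrite gt_eqF.
have pi0 : 0 <= p i ^+ 2 := sqr_ge0 (p i).
have pi1 := p_le1 i.
have q0 : 0 <= 2 * M * (a^-1 - 1) by rewrite !mulr_ge0 ?ltW //; move: ainv; lra.
rewrite /tail_term -/nu -/(kap i) -/(kap i1) /rotation.
case: ifP => [ka|/negbT]; last first.
  rewrite -ltNge mulr1 => ka; have -> : u * (- p i / u) = - p i by field.
  set d := kap i1 - kap i; set m := kap i - nu.
  have -> : 2 * (- p i) ^+ 2 * d + 4 * - p i * p i * (d + M * m) + 2 * p i ^+ 2 * (d + M * m) =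
    - (2 * M * p i ^+ 2 * m) by ring.
  have h := rest_term_gt i q0 (lexx _).
  (* kappa_i > a gives kappa_i / a >= 1 >= nu, so a negative m costs at most kappa_i (1 / a - 1),
     which matches the room left in [rest_term]. *)
  have km : 0 <= kap i * (a^-1 - 1) + m.
    have : 1 <= kap i * a^-1 by rewrite -ler_pdivrMr ?invr_gt0 // invrK mul1r ltW.
    by rewrite /m; move: nu_le1; lra.
  have km0 : 0 <= kap i * (a^-1 - 1) by rewrite mulr_ge0 ?ltW // ; move: ainv; lra.
  have : 0 <= M * (p i ^+ 2 * (kap i * (a^-1 - 1) + m)) by rewrite mulr_ge0 ?(ltW M_gt0) // mulr_ge0.
  have : 0 <= M * ((1 - p i ^+ 2) * (kap i * (a^-1 - 1))).
    by rewrite mulr_ge0 ?(ltW M_gt0) // mulr_ge0 //; lra.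
  nra.
set d := kap i1 - kap i; set m := kap i - nu.
have d0 : 0 < d by rewrite /d; move: k1_gt1 a_le; lra.
have dn : d != 0 by rewrite gt_eqF.
have -> : u * (- p i / u * (1 + M * m / d)) = - p i * (1 + M * m / d) by field; rewrite un dn.
have -> : 2 * (- p i * (1 + M * m / d)) ^+ 2 * d + 4 * (- p i * (1 + M * m / d)) * p i * (d + M * m) +
   2 * p i ^+ 2 * (d + M * m) = - (2 * (M * (- m) * ((M * (- m) - d) / d)) * p i ^+ 2) by field.
have := rest_term_gt i (lexx 0) q0; rewrite mul0r => h.
have m0 : 0 < - m by rewrite /m; move: nu_ge a_gt0; lra.
(* kappa_i <= a gives M (nu - kappa_i) >= M (nu - a) = kappa_1 >= d, so the minimum over the rate of
   the first three summands is nonpositive. *)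
have Mmd : d <= M * - m.
  apply: (@le_trans _ _ (kap i1)); first by rewrite /d; move: (kap_gt0 i); lra.
  by rewrite kap_max ler_pM2l // /m; lra.
have : 0 <= 2 * (M * (- m) * ((M * (- m) - d) / d)) * p i ^+ 2.
  rewrite mulr_ge0 // mulr_ge0 // mulr_ge0 //; first by rewrite ltW // mulr_gt0.
  by rewrite divr_ge0 ?(ltW d0) // subr_ge0.
lra.
Qed.

End Sign.

(** * The conditions at the maximum in a principal frame *)

Section Interior.
Variables (R : realType) (n : nat) (U : set 'rV[R]_n) (D : seq 'rV[R]_n -> 'rV[R]_n -> R).
Hypothesis cD : calculus U D.
Variables (x0 : 'rV[R]_n) (i1 : 'I_n) (E : 'I_n -> 'rV[R]_n) (b c : 'I_n -> R) (M a L C0 : R).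
Hypothesis Ux0 : U x0.
Let w := wD D x0.
Let u := D [::] x0.
Let kap i := w^-1 + u * b i.
Let p i := D [:: E i] x0.

Hypothesis u_gt0 : 0 < u.
Hypothesis E_orth : forall i j, gmet D x0 (E i) (E j) = (i == j)%:R.
Hypothesis E_hess : forall i v, D [:: E i; v] x0 = w * b i * gmet D x0 (E i) v.
Hypothesis quad_max : \forall x \near x0, forall xi,
  (1 - M + M * a * wD D x) * gmet D x xi xi + D [::] x * D [:: xi; xi] x <= 0.
Hypothesis quad_eq : 1 - M + M * a * w = - (u * w * b i1).
Hypothesis C0_ge0 : 0 <= C0.
Hypothesis frame_min : \forall x \near x0, forall eps P, 0 <= eps <= 1 ->
  (forall i j, `|gmet D x (P i) (P j) - (i == j)%:R| <= eps) ->
  - (C0 * eps) <= frame_fun D i1 c (c i1 * M) L x P.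
Hypothesis frame_eq : frame_fun D i1 c (c i1 * M) L x0 E = 0.
Hypothesis c_gt0 : forall i, 0 < c i.
Hypothesis kap_gt0 : forall i, 0 < kap i.
Hypotheses (a_gt0 : 0 < a) (nu_ge : 2 * a <= w^-1).

(** The gradient of u for [gmet]. The third derivatives brought in by the second derivative of w
    along E_i are D^3 u(E_i, E_i, ps), and first-order conditions along [ps] eliminate them. *)
Let ps := w ^- 2 *: gradD D x0.
Let w_gt0 : 0 < w := wD_gt0 D x0.
Let wn : w != 0. Proof. by rewrite gt_eqF. Qed.
Let un : u != 0. Proof. by rewrite gt_eqF. Qed.

Let gradE : dotv (gradD D x0) (gradD D x0) = w ^+ 2 - 1.
Proof. by rewrite wD_sqr addrAC subrr add0r. Qed.

Let D_grad s : D (gradD D x0 :: s) x0 = w ^+ 2 * D (ps :: s) x0.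
Proof. by rewrite /ps (D_scale cD) // mulrA mulfV ?mul1r // expf_neq0. Qed.

Let D_ps : D [:: ps] x0 = 1 - w^-1 ^+ 2.
Proof. by rewrite (D1E cD) // /ps dotvZr gradE; field. Qed.

Let gps v : gmet D x0 v ps = D [:: v] x0.
Proof. by rewrite /gmet D_ps /ps dotvZr dotvC -(D1E cD) //; field. Qed.

Let Sym v v' s : D [:: v, v' & s] x0 = D [:: v', v & s] x0.
Proof. exact: calc_swap cD s v v' x0 Ux0. Qed.

Let D_Eps i : D [:: E i; ps] x0 = w * b i * p i.
Proof. by rewrite E_hess gps. Qed.

Let D_EE i j : D [:: E i; E j] x0 = w * b i * (i == j)%:R.
Proof. by rewrite E_hess E_orth. Qed.

Let D_EEd i : D [:: E i; E i] x0 = w * b i.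
Proof. by rewrite D_EE eqxx mulr1. Qed.

Let E_unit i : gmet D x0 (E i) (E i) = 1.
Proof. by rewrite E_orth eqxx. Qed.

Let jet_w i : jet2 (fun t => wD D (x0 + t *: E i)) (wD D x0) (w ^+ 2 * b i * p i)
  (w * b i ^+ 2 + w * D [:: E i; E i; ps] x0).
Proof.
have w1 : D [:: E i; gradD D x0] x0 = w ^+ 3 * b i * p i.
  by rewrite Sym D_grad Sym D_Eps; ring.
apply: (jet2_eq (jet2_wD cD (E i) Ux0) (fun=> erefl)) => //; rewrite -/w w1.
  by field.
have -> : dotv (hessrow D x0 (E i)) (hessrow D x0 (E i)) = w ^+ 2 * b i ^+ 2 * (1 + w ^+ 2 * p i ^+ 2).
  rewrite (hessrowE cD) // E_hess /gmet dotvC (hessrowE cD) // D_EEd.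
  rewrite (D1E cD (hessrow _ _ _)) // dotvC (hessrowE cD) // w1 -/(p i).
  by ring.
have -> : D [:: E i; E i; gradD D x0] x0 = w ^+ 2 * D [:: E i; E i; ps] x0.
  by rewrite (calc_swap2 cD) // Sym D_grad Sym (calc_swap2 cD).
by field.
Qed.

Let jet_wps : exists w2, jet2 (fun t => wD D (x0 + t *: ps)) (wD D x0) (w * D [:: ps; ps] x0) w2.
Proof.
eexists; apply: (jet2_eq (jet2_wD cD ps Ux0) (fun=> erefl)) => //.
by rewrite -/w Sym D_grad; field.
Qed.

Let x i := D [:: E i; E i1; E i1] x0.
Let y i := D [:: E i1; E i; E i] x0.
Let tau i := D [:: E i; E i; ps] x0.
Let Q i := D [:: E i1; E i1; E i; E i] x0.
Let B := D [:: ps; ps] x0.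
Let k := rotation i1 p b u w a M.

(** The vector is kept constant along [ps]: at a maximizing vector its variation has no first-order
    effect. *)
Let max1 : M * a * (w * B) - u * w * b i1 * (2 * (p i1 * (w * b i1 * p i1)))
  + (1 - w^-1 ^+ 2) * (w * b i1) + u * tau i1 = 0.
Proof.
have [w2 jw] := jet_wps.
have H0 : (1 - M + M * a * wD D x0) * gmet D x0 (E i1) (E i1) + D [::] x0 * D [:: E i1; E i1] x0 = 0.
  by rewrite E_unit D_EEd -/w quad_eq -/u; ring.
have g1 : gmet D x0 (E i1) (E i1) = 1 by rewrite E_orth eqxx.
have [+ _] := max_direction cD Ux0 0 quad_max H0 g1 jw.
rewrite -/w quad_eq (Sym ps) D_Eps (calc_zero cD) // D_EEd D_ps.
rewrite (calc_swap cD [::] (E i1) 0) // (calc_zero cD) //.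
have -> : dotv (E i1) 0 = 0 by apply: big1 => j _; rewrite mxE mulr0.
have -> : D [:: ps; E i1; E i1] x0 = tau i1 by rewrite Sym (calc_swap2 cD).
by move=> <-; rewrite -/u -/(p i1) /B; ring.
Qed.

(** Along E_i the vector E_1 turns towards E_i at the rate p_1 / u of hyperbolic parallel transport;
    the part of that transport along E_1 only rescales the vector and is dropped. *)
Let maxi i : i != i1 ->
  M * a * (w ^+ 2 * b i * p i) + p i * (w * b i1) + u * x i = 0 /\
  let m := p i1 / u in
  M * a * (w * b i ^+ 2 + w * tau i) - u * w * b i1 * (2 * (m ^+ 2 + p i1 * (y i + 2 * (m * (w * b i)))))
  + w * b i * (w * b i1) + 2 * p i * x i + u * (Q i + 4 * (m * y i) + 2 * (m ^+ 2 * (w * b i))) <= 0.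
Proof.
move=> ii; set m := p i1 / u.
have H0 : (1 - M + M * a * wD D x0) * gmet D x0 (E i1) (E i1) + D [::] x0 * D [:: E i1; E i1] x0 = 0.
  by rewrite E_unit D_EEd -/w quad_eq -/u; ring.
have g1 : gmet D x0 (E i1) (E i1) = 1 by rewrite E_orth eqxx.
have := max_direction cD Ux0 (m *: E i) quad_max H0 g1 (jet_w i).
have e0 : (i == i1) = false by exact: negbTE.
have D1 : D [:: E i; E i1] x0 = 0 by rewrite D_EE e0 mulr0.
have D2 : D [:: m *: E i] x0 = m * p i by rewrite (D_scale cD).
have D3 : D [:: E i1; m *: E i] x0 = 0 by rewrite (D_scale2 cD) // Sym D1 mulr0.
have D4 : D [:: E i; m *: E i] x0 = m * (w * b i) by rewrite (D_scale2 cD) // D_EEd.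
have D5 : D [:: m *: E i; m *: E i] x0 = m ^+ 2 * (w * b i).
  by rewrite (D_scale cD) // D4; ring.
have yE : D [:: E i; E i; E i1] x0 = y i by rewrite (calc_swap2 cD) // Sym.
have D6 : D [:: E i; E i1; m *: E i] x0 = m * y i.
  by rewrite (calc_swap2 cD) // (D_scale2 cD) // yE.
have D7 : D [:: E i; E i; E i1; E i1] x0 = Q i.
  by rewrite (calc_swap2 cD) // Sym (calc_swap3 cD) // (calc_swap2 cD).
have gi : gmet D x0 (E i1) (E i) = 0 by rewrite E_orth eq_sym e0.
have d1 : dotv (E i1) (m *: E i) = - (m * (p i1 * p i)).
  by move: gi; rewrite dotvZr /gmet -/(p i1) -/(p i) => h; rewrite -mulrN; congr (_ * _); lra.
have d2 : dotv (m *: E i) (m *: E i) = m ^+ 2 * (1 - p i ^+ 2).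
  have := E_unit i; rewrite /gmet -/(p i) dotvZl dotvZr => <-; ring.
rewrite D1 D2 D3 D4 D5 D6 D7 d1 d2 yE !D_EEd -/w -/u -/(p i) -/(p i1) -/(x i) -/(tau i) quad_eq.
move=> [e1 e2]; split; first by rewrite -e1; ring.
by move: e2; congr (_ <= 0); ring.
Qed.

Let frame1 : \sum_(i | i != i1) c i * ((1 - w^-1 ^+ 2) * (w * b i) + u * (tau i - 2 * (w * b i * p i) ^+ 2))
  - L * (w * B) = 0.
Proof.
have [w2 jw] := jet_wps.
(* Parallel transport along [ps] for the Levi-Civita connection of [gmet], whose Christoffel term is
   D^2 u(ps, E_i) ps. *)
pose A i := - (w * b i * p i) *: ps.
have q0 i : D [:: ps; E i] x0 + D [:: A i] x0 = w * b i * p i * w^-1 ^+ 2.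
  by rewrite Sym D_Eps /A (D_scale cD) // D_ps; ring.
have dA i j : dotv (E i) (A j) = - (w * b j * p j) * (p i * w^-1 ^+ 2).
  rewrite /A dotvZr; congr (_ * _).
  by have := gps (E i); rewrite /gmet D_ps -/(p i) => h; move: h; lra.
have [|+ _] := frame_direction cD Ux0 E_orth E_hess C0_ge0 frame_min frame_eq (A := A) jw.
  move=> i j; rewrite !q0 (dotvC (A i)) !dA -/(p i) -/(p j); ring.
rewrite D_ps -/u -/B => e1; rewrite -[RHS]e1; congr (_ - _); apply: eq_bigr => i _.
rewrite D_EEd /A (D_scale2 cD) // D_Eps.
have -> : D [:: ps; E i; E i] x0 = tau i by rewrite Sym (calc_swap2 cD).
by ring.
Qed.

(** E_1 turns towards E_j at rate k_j and E_j turns back. The [ps] term is the Christoffel term D^2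
    u(E_1, E_1) ps, whose mixed analogues D^2 u(E_1, E_j) ps vanish. E_1 itself is absent from
    [frame_fun] and moves only to keep the full Gram matrix. *)
Let A i := if i == i1 then - (w * b i1) *: ps + \sum_(j | j != i1) k j *: E j else - k i *: E i1.

Let gA i j : j != i1 -> gmet D x0 (E j) (A i) = if i == i1 then - (w * b i1) * p j + k j else 0.
Proof.
move=> jj; rewrite /A; case: ifP => _.
  rewrite (gmetDr cD) // (gmetZr cD) // gps; congr (_ + _).
  rewrite gmetC (gmet_suml cD) // (bigD1 j) //= E_orth eqxx mulr1 big1 ?addr0 // => l /andP [_ lj].
  by rewrite E_orth (negbTE lj) mulr0.
by rewrite (gmetZr cD) // E_orth (negbTE jj) mulr0.
Qed.

Let gA1 i : gmet D x0 (E i1) (A i) = if i == i1 then - (w * b i1) * p i1 else - k i.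
Proof.
rewrite /A; case: ifP => _; last by rewrite (gmetZr cD) // E_unit mulr1.
rewrite (gmetDr cD) // (gmetZr cD) // gps gmetC (gmet_suml cD) // big1 ?addr0 // => l li.
by rewrite E_orth (negbTE li) mulr0.
Qed.

Let gram1 i j : dotv (E i) (A j) + dotv (A i) (E j) +
  (p i * (D [:: E i1; E j] x0 + D [:: A j] x0) + (D [:: E i1; E i] x0 + D [:: A i] x0) * p j) = 0.
Proof.
have -> : dotv (E i) (A j) + dotv (A i) (E j) +
  (p i * (D [:: E i1; E j] x0 + D [:: A j] x0) + (D [:: E i1; E i] x0 + D [:: A i] x0) * p j) =
  gmet D x0 (E i) (A j) + gmet D x0 (E j) (A i) + p i * D [:: E i1; E j] x0 + D [:: E i1; E i] x0 * p j.
  by rewrite /gmet (dotvC (A i)) -/(p i) -/(p j); ring.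
have DE1 l : D [:: E i1; E l] x0 = if l == i1 then w * b i1 else 0.
  by rewrite D_EE eq_sym; case: eqP => // _; rewrite ?mulr1 ?mulr0.
rewrite !DE1; have [->|ii] := eqVneq i i1; have [->|jj] := eqVneq j i1.
- by rewrite !gA1 eqxx; ring.
- by rewrite gA1 gA // (negbTE jj) eqxx; ring.
- by rewrite gA1 gA // (negbTE ii) eqxx; ring.
- by rewrite !gA // (negbTE ii) (negbTE jj); ring.
Qed.

Let frame_i1 :
  \sum_(i | i != i1) c i * (p i1 * (w * b i) + u * y i) - L * (w ^+ 2 * b i1 * p i1) = 0 /\
  0 <= \sum_(i | i != i1) c i * (w * b i1 * (w * b i) + 2 * p i1 * y i
    + u * (Q i - 4 * (k i * x i) + 2 * (k i ^+ 2 * (w * b i1))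
      - w * b i * (2 * (k i ^+ 2 + p i * (x i - 2 * (k i * (w * b i1)))))))
  - L * (w * b i1 ^+ 2 + w * tau i1).
Proof.
have [e1 e2] := frame_direction cD Ux0 E_orth E_hess C0_ge0 frame_min frame_eq (jet_w i1) gram1.
have AE i : i != i1 -> A i = - k i *: E i1 by rewrite /A => /negbTE ->.
have D1 i : i != i1 -> D [:: E i; A i] x0 = 0.
  by move=> ii; rewrite AE // (D_scale2 cD) // D_EE (negbTE ii) !mulr0.
split.
  rewrite -[RHS]e1; congr (_ - _); apply: eq_bigr => i ii.
  by rewrite D1 // D_EEd -/u -/(p i1) -/(y i); ring.
move: e2; congr (_ <= _ - _); apply: eq_bigr => i ii.
rewrite D1 // AE // !D_EEd -/u -/(p i1) -/(y i) -/(Q i) -/w -/(p i).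
rewrite !(D_scale2 cD) // !(D_scale cD) // (calc_swap2 cD [::] (E i1) (E i)) // (D_scale2 cD) //.
rewrite D_EEd [D [:: E i1; E i] x0]D_EE eq_sym (negbTE ii) mulr0n mulr0 -/(p i1).
have -> : D [:: E i1; E i1; E i] x0 = x i by rewrite (calc_swap2 cD) // Sym.
have -> : dotv (- k i *: E i1) (- k i *: E i1) = k i ^+ 2 * (1 - p i1 ^+ 2).
  have := E_unit i1; rewrite /gmet -/(p i1) dotvZl dotvZr => <-; ring.
by ring.
Qed.

Lemma interior_max_bound : M <= 4 / a ^+ 3.
Proof.
rewrite leNgt; apply/negP => hM.
have eqL : \sum_(i | i != i1) c i * (1 + u * (w * b i)) + c i1 * M - L * w = 0.
  rewrite -[RHS]frame_eq /frame_fun; congr (_ + _ - _); apply: eq_bigr => i _.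
  by rewrite D_EEd.
have [e1 e2] := frame_i1.
have := combined_inequality w_gt0 u_gt0 quad_eq eqL max1 (fun i ii => (maxi ii).1)
   (fun i ii => (maxi ii).2) frame1 e1 e2 (fun i => ltW (c_gt0 i)).
have kmax : kap i1 = M * (w^-1 - a).
  rewrite /kap; apply: (mulIf wn).
  have -> : (w^-1 + u * b i1) * w = w^-1 * w + u * w * b i1 by ring.
  have -> : M * (w^-1 - a) * w = M * (w^-1 * w) - M * a * w by ring.
  by rewrite mulVf //; move: quad_eq; lra.
have nu1 : w^-1 <= 1.
  rewrite invf_le1 // -[leLHS]sqrtr1 /w /wD ler_wsqrtr // lerDl; exact: dotv_ge0.
have p1 i : p i ^+ 2 <= 1.
  by have := E_unit i; rewrite /gmet -/(p i) -expr2 => <-; rewrite lerDr dotv_ge0.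
have ht := tail_term_lt0 a_gt0 nu_ge nu1 u_gt0 hM kmax kap_gt0 p1.
have hh := head_term_lt0 p a_gt0 nu_ge nu1 hM kmax kap_gt0.
have h1 : c i1 * head_term i1 p b u w a M < 0.
  by rewrite nmulr_llt0 //.
have h2 : \sum_(i | i != i1) c i * tail_term i1 p b k u w a M i <= 0.
  by apply: sumr_le0 => i _; rewrite mulr_ge0_le0 ?ltW // ltW.
by rewrite leNgt => /negP; apply; lra.
Qed.

End Interior.

(** * The shape operator *)

Section Shape.
Variables (R : realType) (n : nat) (U : set 'rV[R]_n) (u : 'rV[R]_n -> R).
Variable D : seq 'rV[R]_n -> 'rV[R]_n -> R.
Hypothesis cD : calculus U D.
Variable x : 'rV[R]_n.
Hypothesis DuE : forall i, Du u x i = D [:: ebas R i] x.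
Hypothesis D2u_entry : forall i j, D2u u x i j = D [:: ebas R i; ebas R j] x.
Hypothesis Ux : U x.
Let p := gradD D x.
Let w := wD D x.
Let w_gt0 : 0 < w := wD_gt0 D x.
Let wn : w != 0. Proof. by rewrite gt_eqF. Qed.
Let w1n : 1 + w != 0. Proof. by rewrite gt_eqF // addr_gt0. Qed.
Implicit Types v xi : 'rV[R]_n.

Lemma gradD_Du i : p ord0 i = Du u x i.
Proof. by rewrite mxE DuE. Qed.

Lemma wgraphE : wgraph u x = w.
Proof.
rewrite /w /wD /wgraph; congr (Num.sqrt (_ + _)); apply: eq_bigr => i _.
by rewrite gradD_Du expr2.
Qed.

Lemma gradD_sqr : dotv p p = w ^+ 2 - 1.
Proof. by rewrite /w wD_sqr addrAC subrr add0r. Qed.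

Lemma D2uE v v' : dotv (v *m D2u u x) v' = D [:: v; v'] x.
Proof.
rewrite {2}(row_ebas v) (D_sum cD) //.
under [RHS]eq_bigr => i _.
  rewrite (calc_swap cD) // {1}(row_ebas v') (D_sum cD) // big_distrr /=.
  under eq_bigr => j _ do rewrite (calc_swap cD [::] (ebas R j) (ebas R i) Ux).
  over.
rewrite exchange_big /=; apply: eq_bigr => j _; rewrite mxE big_distrl /=.
by apply: eq_bigr => i _; rewrite D2u_entry; ring.
Qed.

Lemma D2u_tr : (D2u u x)^T = D2u u x.
Proof.
apply/matrixP => i j; rewrite mxE !D2u_entry.
exact: (calc_swap cD [::] (ebas R j) (ebas R i) Ux).
Qed.

Lemma gammaE v : v *m gammamx u x = v - (dotv v p / (w * (1 + w))) *: p.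
Proof.
apply/rowP => j; rewrite [LHS]mxE [RHS]mxE [X in _ = _ + X]mxE [X in _ = _ - X]mxE gradD_Du.
have -> : (dotv v p / (w * (1 + w))) * Du u x j = \sum_i v ord0 i * (Du u x i * Du u x j / (w * (1 + w))).
  by rewrite /dotv !big_distrl /=; apply: eq_bigr => i _; rewrite gradD_Du; ring.
under eq_bigr => i _ do rewrite mxE mulrBr wgraphE.
rewrite sumrB; congr (_ - _); rewrite (bigD1 j) //= eqxx mulr1 big1 ?addr0 // => i /negbTE ->.
by rewrite mulr0.
Qed.

Lemma gamma_tr : (gammamx u x)^T = gammamx u x.
Proof. by apply/matrixP => i j; rewrite !mxE eq_sym (mulrC (Du u x i)). Qed.

(* the inverse of gamma, i.e. the square root of the first fundamental form *)
Definition groot v := v + (dotv v p / (1 + w)) *: p.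

Lemma groot_gamma v : groot v *m gammamx u x = v.
Proof.
rewrite gammaE /groot dotvDl dotvZl gradD_sqr -addrA -scalerBl.
set c := (X in X *: p); suff -> : c = 0 by rewrite scale0r addr0.
by rewrite /c; field; rewrite wn w1n.
Qed.

Lemma gamma_groot v : groot (v *m gammamx u x) = v.
Proof.
rewrite /groot gammaE dotvDl -scaleNr dotvZl gradD_sqr -addrA -scalerDl.
set c := (X in X *: p); suff -> : c = 0 by rewrite scale0r addr0.
by rewrite /c; field; rewrite wn w1n.
Qed.

Lemma groot_dot v v' : dotv (groot v) (groot v') = gmet D x v v'.
Proof.
rewrite /groot /gmet !(D1E cD) // -/p !(dotvDl, dotvDr, dotvZl, dotvZr) gradD_sqr (dotvC p v) (dotvC p v').
by field.
Qed.

Lemma shapeE xi xi' : dotv (xi *m hyp_shape u x) xi' =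
  w^-1 * dotv xi xi' + u x / w * D [:: xi *m gammamx u x; xi' *m gammamx u x] x.
Proof.
rewrite /hyp_shape mulmxDr -!scalemxAr mulmx1 dotvDl !dotvZl /nu_last wgraphE; congr (_ + _ * _).
by rewrite !mulmxA dotv_mulmx gamma_tr D2uE.
Qed.

(** [groot] is an isometry from [gmet] to the standard dot product, so [hyp_shape] is identified
    with the form (g + u D^2 u) / w, with no square root left. *)
Lemma shape_groot v v' : dotv (groot v *m hyp_shape u x) (groot v') =
  w^-1 * gmet D x v v' + u x / w * D [:: v; v'] x.
Proof. by rewrite shapeE !groot_gamma groot_dot. Qed.

Lemma shape_tr : (hyp_shape u x)^T = hyp_shape u x.
Proof.
rewrite /hyp_shape linearD /= !linearZ /= trmx1; congr (_ + _ *: _).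
by rewrite !trmx_mul gamma_tr D2u_tr mulmxA.
Qed.

End Shape.

(** * The largest eigenvalue as a maximum of Rayleigh quotients *)

Section Eigen.
Variables (R : realType) (n : nat) (A : 'M[R]_n).
Hypotheses (n_gt0 : (0 < n)%N) (A_tr : A^T = A).
Implicit Types xi : 'rV[R]_n.

Let spec := [set l : R | eigenvalue A l].

Lemma eigenvalue_le m : (forall xi, dotv xi xi = 1 -> dotv (xi *m A) xi <= m) ->
  forall l, spec l -> l <= m.
Proof.
move=> h l /eigenvalueP [v vA v0].
have d0 := dotv_gt0 v0; pose s := Num.sqrt (dotv v v).
have s2 : s * s = dotv v v by rewrite -expr2 sqr_sqrtr // ltW.
have s0 : s != 0 by rewrite gt_eqF // sqrtr_gt0.
have := h (s^-1 *: v); rewrite -scalemxAl vA !(dotvZl, dotvZr) -s2.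
have -> : s^-1 * (s^-1 * (s * s)) = 1 by field.
have -> : s^-1 * (l * (s^-1 * (s * s))) = l by field.
by apply.
Qed.

Lemma eigenvalue_sup_ge xi : dotv xi xi = 1 -> dotv (xi *m A) xi <= sup spec.
Proof.
move=> xi1; have [Q [k [QO AE]]] := sym_spectral A_tr.
(* Without an upper bound [sup] would only be a default value. *)
have bnd : has_ubound spec.
  exists (\sum_i `|k ord0 i|) => l; apply: eigenvalue_le => v v1.
  rewrite (spectral_quad AE); apply: ler_sum => i _.
  have d1 : dotv v (row i Q) ^+ 2 <= 1.
    rewrite -v1 [leRHS](spectral_norm QO) (bigD1 i) //= lerDl.
    by apply: sumr_ge0 => j _; exact: sqr_ge0.
  apply: (le_trans (ler_norm _)); rewrite normrM ler_piMr // ger0_norm ?sqr_ge0 //.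
have ki i : k ord0 i <= sup spec.
  apply: ub_le_sup => //; apply/eigenvalueP; exists (row i Q); first exact: row_eigen.
  by rewrite -dotv_eq0 (dotv_row_orth QO) eqxx oner_eq0.
rewrite (spectral_quad AE) -[leRHS]mulr1 -xi1 [in leRHS](spectral_norm QO) big_distrr /=.
by apply: ler_sum => i _; rewrite ler_wpM2r ?sqr_ge0.
Qed.

Lemma eigenvalue_nonempty : spec !=set0.
Proof.
have [Q [k [QO AE]]] := sym_spectral A_tr; pose i := Ordinal n_gt0.
exists (k ord0 i); apply/eigenvalueP; exists (row i Q); first exact: row_eigen.
by rewrite -dotv_eq0 (dotv_row_orth QO) eqxx oner_eq0.
Qed.

Lemma eigenvalue_sup_le m : (forall xi, dotv xi xi = 1 -> dotv (xi *m A) xi <= m) ->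
  sup spec <= m.
Proof. by move=> h; apply: ge_sup; [exact: eigenvalue_nonempty|exact: eigenvalue_le]. Qed.

Lemma dotv_shape_scale m : (forall xi, dotv xi xi = 1 -> dotv (xi *m A) xi <= m) ->
  forall xi, dotv (xi *m A) xi <= m * dotv xi xi.
Proof.
move=> h v; have [->|v0] := eqVneq v 0.
  by rewrite mul0mx -(scale0r (0 : 'rV[R]_n)) !dotvZl !mul0r mulr0.
have d0 := dotv_gt0 v0; pose s := Num.sqrt (dotv v v).
have s2 : s * s = dotv v v by rewrite -expr2 sqr_sqrtr // ltW.
have s0 : s != 0 by rewrite gt_eqF // sqrtr_gt0.
have := h (s^-1 *: v); rewrite -scalemxAl !(dotvZl, dotvZr).
have -> : s^-1 * (s^-1 * dotv v v) = 1 by rewrite -s2; field.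
move=> /(_ erefl); have -> : s^-1 * (s^-1 * dotv (v *m A) v) = dotv (v *m A) v / dotv v v.
  by rewrite -s2; field.
by rewrite ler_pdivrMr.
Qed.

End Eigen.

(** * Existence of a maximum *)

Section ContinuousAt.
Variables (R : realType) (T : topologicalType) (z : T).
Implicit Types f g : T -> R.

Definition cont_at f := f t @[t --> z] --> f z.

Lemma cont_cst (c : R) : cont_at (fun=> c).
Proof. exact: cvg_cst. Qed.

Lemma cont_add f g : cont_at f -> cont_at g -> cont_at (fun t => f t + g t).
Proof. by move=> cf cg; exact: cvgD. Qed.

Lemma cont_mul f g : cont_at f -> cont_at g -> cont_at (fun t => f t * g t).
Proof. by move=> cf cg; exact: cvgM. Qed.

Lemma cont_opp f : cont_at f -> cont_at (fun t => - f t).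
Proof. by move=> cf; exact: cvgN. Qed.

Lemma cont_sub f g : cont_at f -> cont_at g -> cont_at (fun t => f t - g t).
Proof. by move=> cf cg; apply: cont_add => //; exact: cont_opp. Qed.

Lemma cont_inv f : f z != 0 -> cont_at f -> cont_at (fun t => (f t)^-1).
Proof. by move=> f0 cf; exact: cvgV. Qed.

Lemma cont_sqrt f : cont_at f -> cont_at (fun t => Num.sqrt (f t)).
Proof. by move=> cf; rewrite /cont_at; apply: continuous_cvg => //; exact: sqrt_continuous. Qed.

Lemma cont_sum (I : finType) (P : pred I) (F : I -> T -> R) :
  (forall i, cont_at (F i)) -> cont_at (fun t => \sum_(i | P i) F i t).
Proof.
move=> cF; rewrite /cont_at; elim: (index_enum I) => [|i r IH].
  under eq_fun do rewrite big_nil; rewrite big_nil; exact: cvg_cst.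
under eq_fun do rewrite big_cons; rewrite big_cons; case: ifP => // _.
by apply: cont_add => //; exact: cF.
Qed.

End ContinuousAt.

Lemma cont_fst (R : realType) (S T : topologicalType) (f : S -> R) (z : S * T) :
  cont_at z.1 f -> cont_at z (fun t => f t.1).
Proof.
case: z => x y /= cf; exact: (@cvg_comp _ _ _ fst f (nbhs (x, y)) (nbhs x) _ cvg_fst cf).
Qed.

Lemma cont_snd (R : realType) (S T : topologicalType) (f : T -> R) (z : S * T) :
  cont_at z.2 f -> cont_at z (fun t => f t.2).
Proof.
case: z => x y /= cf; exact: (@cvg_comp _ _ _ snd f (nbhs (x, y)) (nbhs y) _ cvg_snd cf).
Qed.

Section MaxRayleigh.
Variables (R : realType) (n : nat).
Hypothesis n_gt0 : (0 < n)%N.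

Lemma cont_coord i (v : 'rV[R]_n) : cont_at v (fun t => t ord0 i).
Proof. exact: coord_continuous. Qed.

Lemma sphere_compact : compact [set xi : 'rV[R]_n | dotv xi xi = 1].
Proof.
apply: bounded_closed_compact.
  exists 1; split; first exact: num_real.
  move=> M M1 xi /= xi1; apply: le_trans (ltW M1).
  rewrite [leLHS]/Num.Def.normr /= mx_normrE; apply/bigmax_leP; split => //= -[i j] _ /=.
  rewrite ord1 -[leRHS](@normr1 R) -ler_sqr ?nnegrE // !real_normK ?num_real // expr1n -xi1.
  rewrite /dotv (bigD1 j) //= -expr2 lerDl; apply: sumr_ge0 => k _.
  by rewrite -expr2 sqr_ge0.
rewrite (_ : [set xi : 'rV[R]_n | dotv xi xi = 1] = (fun xi => dotv xi xi) @^-1` [set x | x = 1]) //.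
apply: closed_comp; last exact: closed_eq.
move=> v _; apply: cont_sum => i; apply: cont_mul; exact: cont_coord.
Qed.

Lemma closure_compact (A : set 'rV[R]_n) : bounded_set A -> compact (closure A).
Proof.
move=> [M [Mr hM]]; apply: bounded_closed_compact; last exact: closed_closure.
exists (M + 1); split; first by rewrite realD.
move=> K MK x; have : closed [set y : 'rV[R]_n | `|y| <= M + 1].
  rewrite (_ : [set y : 'rV[R]_n | `|y| <= M + 1] = (fun y => `|y|) @^-1` [set r | r <= M + 1]) //.
  by apply: closed_comp; [move=> v _; exact: norm_continuous|exact: closed_le].
rewrite closure_id => E cx; apply: le_trans (ltW MK).
have : closure [set y : 'rV[R]_n | `|y| <= M + 1] x.
  by apply: closureS cx => y Ay; apply: (hM (M + 1)) => //; rewrite ltrDl.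
by rewrite -E.
Qed.

Lemma max_rayleigh (K : set 'rV[R]_n) (A : 'rV[R]_n -> 'M[R]_n) (h : 'rV[R]_n -> R) :
  compact K -> K !=set0 -> (forall x i j, K x -> cont_at x (fun y => A y i j)) ->
  (forall x, K x -> cont_at x h) -> (forall x, K x -> 0 < h x) ->
  exists x0 xi0, [/\ K x0, dotv xi0 xi0 = 1 &
    forall x xi, K x -> dotv xi xi = 1 -> dotv (xi *m A x) xi / h x <= dotv (xi0 *m A x0) xi0 / h x0].
Proof.
move=> cK [x1 Kx1] cA ch h0.
pose F (z : 'rV[R]_n * 'rV[R]_n) := dotv (z.2 *m A z.1) z.2 / h z.1.
pose S := K `*` [set xi : 'rV[R]_n | dotv xi xi = 1].
have cS : compact S by apply: compact_setX => //; exact: sphere_compact.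
have S0 : S !=set0.
  pose i := Ordinal n_gt0; exists (x1, ebas R i); split => //=.
  rewrite /dotv (bigD1 i) //= !mxE eqxx mulr1 big1 ?addr0 // => j ji.
  by rewrite !mxE (negbTE ji) mul0r.
have cF : {within S, continuous F}.
  apply: continuous_in_subspaceT => z /[!inE] -[/= Kz _].
  have E : F = fun z => (\sum_j (\sum_i z.2 ord0 i * A z.1 i j) * z.2 ord0 j) / h z.1.
    by apply/funext => y; rewrite /F /dotv; congr (_ / _); apply: eq_bigr => j _; rewrite mxE.
  suff : cont_at z F by [].
  rewrite E; apply: cont_mul; last first.
    by apply: cont_inv; [rewrite gt_eqF // h0|apply: cont_fst; exact: ch].
  apply: cont_sum => j; apply: cont_mul; last by exact: (cont_snd (@cont_coord j z.2)).
  apply: cont_sum => i; apply: cont_mul.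
    exact: (cont_snd (@cont_coord i z.2)).
  exact: (cont_fst (cA z.1 i j Kz)).
have [[x0 xi0] /[!inE] -[/= Kx0 xi01] hm] := compact_EVT_max S0 cS cF.
exists x0, xi0; split => // x xi Kx xi1.
by apply: (hm (x, xi)); rewrite inE.
Qed.

End MaxRayleigh.

(** * Interior maxima *)

Section AtMaximum.
Variables (R : realType) (n : nat) (U : set 'rV[R]_n) (u : 'rV[R]_n -> R).
Variable D : seq 'rV[R]_n -> 'rV[R]_n -> R.
Hypothesis cD : calculus U D.
Hypothesis D0E : forall x, u x = D [::] x.
Hypothesis D1E : forall x i, Du u x i = D [:: ebas R i] x.
Hypothesis D2E : forall x i j, D2u u x i j = D [:: ebas R i; ebas R j] x.
Variables (Om : set 'rV[R]_n) (x0 : 'rV[R]_n) (a M sigma : R) (c : 'I_n -> R).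
Hypotheses (oOm : open Om) (OmU : Om `<=` U) (Omx0 : Om x0).
Hypothesis u_gt0 : forall x, Om x -> 0 < u x.
Hypotheses (a_gt0 : 0 < a) (M_gt0 : 0 < M).
Hypothesis nu_ge : forall x, Om x -> 2 * a <= (wD D x)^-1.
Hypothesis c_gt0 : forall i, 0 < c i.
Hypothesis quad_le : forall x xi, Om x -> dotv xi xi = 1 ->
  dotv (xi *m hyp_shape u x) xi <= M * ((wD D x)^-1 - a).
Hypothesis spectrum : forall x (Q : 'M[R]_n) k, Om x -> orthomx Q ->
  hyp_shape u x = Q^T *m diag_mx k *m Q ->
  (forall i, 0 < k ord0 i) /\ forall s : 'S_n, sigma <= \sum_i c i * k ord0 (s i).

Let shapeD x v v' :
  Om x -> wD D x * dotv (groot D x v *m hyp_shape u x) (groot D x v') = gmet D x v v' + u x * D [:: v; v'] x.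
Proof.
move=> Ox; have wn : wD D x != 0 by rewrite gt_eqF // wD_gt0.
by rewrite (shape_groot cD (D1E x) (D2E x) (OmU Ox)); field.
Qed.

Let quadD x xi : Om x ->
  (1 - M + M * a * wD D x) * gmet D x xi xi + D [::] x * D [:: xi; xi] x <= 0.
Proof.
move=> Ox; have w0 := wD_gt0 D x; have wn : wD D x != 0 by rewrite gt_eqF.
have := dotv_shape_scale (fun v => quad_le Ox) (groot D x xi).
rewrite (groot_dot cD (OmU Ox)) -(ler_pM2l w0) shapeD // -D0E.
have -> : wD D x * (M * ((wD D x)^-1 - a) * gmet D x xi xi) = (M - M * a * wD D x) * gmet D x xi xi.
  by field.
lra.
Qed.

Section FrameBound.
Variable i1 : 'I_n.
Let L := c i1 * (M * a) + sigma.
Let S := \sum_i c i.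
(** Three errors: the loss in Schur's inequality, multiplied by w <= 1 / (2 a); the replacement of
    g(P_i, P_i) <= 1 + eps by 1 in the kept summands; and the same in the bound for the summand
    [i1]. *)
Definition frame_const := (2 * a)^-1 * (2 * n%:R * M * S) + S + c i1 * M.

Let S_ge0 : 0 <= S. Proof. by apply: sumr_ge0 => i _; exact: ltW. Qed.

Let w_le x : Om x -> wD D x <= (2 * a)^-1.
Proof.
move=> Ox; have a2 : 0 < 2 * a by rewrite mulr_gt0.
by rewrite -[wD D x]invrK lef_pV2 ?posrE ?invr_gt0 ?wD_gt0 // nu_ge.
Qed.

Let wD_ge1 x : 1 <= wD D x.
Proof. by rewrite -[leLHS]sqrtr1 ler_wsqrtr // lerDl dotv_ge0. Qed.

Lemma frame_const_ge0 : 0 <= frame_const.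
Proof.
rewrite /frame_const !addr_ge0 // ?mulr_ge0 ?invr_ge0 ?mulr_ge0 //.
all: by rewrite ltW.
Qed.

(** Schur's inequality is applied at x to the rows [groot D x (P i)], which have the Gram matrix of
    P for [gmet]. After multiplication by w, the summand [i1] is bounded above through [quadD]. *)
Lemma frame_fun_ge x eps P : Om x -> 0 <= eps <= 1 ->
  (forall i j, `|gmet D x (P i) (P j) - (i == j)%:R| <= eps) ->
  - (frame_const * eps) <= frame_fun D i1 c (c i1 * M) L x P.
Proof.
move=> Ox /andP [e0 e1] hP; have Ux := OmU Ox.
have w0 := wD_gt0 D x; have wn : wD D x != 0 by rewrite gt_eqF.
have [Q [k [QO AE]]] := sym_spectral (shape_tr cD (D2E x) Ux).
have [k0 ks] := spectrum Ox QO AE.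
have nu1 : (wD D x)^-1 <= 1 by rewrite invf_le1.
have kM i : 0 <= k ord0 i <= M.
  rewrite ltW //=; have := quad_le Ox (xi := row i Q).
  rewrite (dotv_row_orth QO) eqxx => /(_ erefl).
  rewrite (row_eigen QO AE) dotvZl (dotv_row_orth QO) eqxx mulr1 => h.
  by apply: (le_trans h); rewrite ger_pMr //; move: a_gt0; lra.
pose T : 'M[R]_n := \matrix_i groot D x (P i).
have rT i : row i T = groot D x (P i) by rewrite rowK.
have hT i j : `|(T *m T^T) i j - (i == j)%:R| <= eps.
  by rewrite mulmx_trE !rT (groot_dot cD Ux).
have := trace_lower_bound QO kM (fun i => ltW (c_gt0 i)) e0 ks hT.
rewrite -AE -(ler_pM2l w0) [X in _ <= X]big_distrr /=.
have E i : wD D x * (c i * (T *m hyp_shape u x *m T^T) i i) =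
    c i * (gmet D x (P i) (P i) + D [::] x * D [:: P i; P i] x).
  by rewrite mulmx_trE row_mul rT mulrCA shapeD // D0E.
under [X in _ <= X]eq_bigr => i _ do rewrite E.
rewrite [X in _ <= X](bigD1 i1) //= => h.
have gle i : gmet D x (P i) (P i) <= 1 + eps.
  by have := hP i i; rewrite eqxx mulr1n ler_norml => /andP [_]; lra.
have h1 : gmet D x (P i1) (P i1) + D [::] x * D [:: P i1; P i1] x <= (M - M * a * wD D x) * (1 + eps).
  have := quadD (P i1) Ox.
  have : (M - M * a * wD D x) * gmet D x (P i1) (P i1) <= (M - M * a * wD D x) * (1 + eps).
    apply: ler_wpM2l (gle i1); have aw : a * wD D x <= 1.
      have := ler_wpM2r (ltW w0) (nu_ge Ox); rewrite mulVf //.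
      have : 0 <= a * wD D x by rewrite mulr_ge0 ?ltW.
      lra.
    by rewrite -mulrA -[X in X - _]mulr1 -mulrBr mulr_ge0 ?(ltW M_gt0) // subr_ge0.
  lra.
have h2 : \sum_(i | i != i1) c i * (gmet D x (P i) (P i) + D [::] x * D [:: P i; P i] x) <=
    \sum_(i | i != i1) c i * (1 + D [::] x * D [:: P i; P i] x) + eps * S.
  apply: (@le_trans _ _ (\sum_(i | i != i1) (c i * (1 + D [::] x * D [:: P i; P i] x) + eps * c i))).
    apply: ler_sum => i _; have := ler_wpM2l (ltW (c_gt0 i)) (gle i); lra.
  rewrite big_split /= lerD2l -big_distrr /= ler_wpM2l //.
  by rewrite /S [leRHS](bigD1 i1) //= lerDr ltW.
have h3 := ler_wpM2l (ltW (c_gt0 i1)) h1.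
have h4 : wD D x * (2 * (n%:R * eps) * M * S) <= (2 * a)^-1 * (2 * n%:R * M * S) * eps.
  have -> : wD D x * (2 * (n%:R * eps) * M * S) = wD D x * (2 * n%:R * M * S) * eps by ring.
  have nS : 0 <= 2 * n%:R * M * S by rewrite mulr_ge0 // mulr_ge0 ?(ltW M_gt0) // mulr_ge0.
  by rewrite ler_wpM2r // ler_wpM2r // w_le.
have h5 : 0 <= c i1 * (M * a * wD D x) * eps by rewrite !mulr_ge0 // ltW.
rewrite /frame_fun /L /frame_const -/S; move: h; rewrite -/S; lra.
Qed.

End FrameBound.

Variables (Q : 'M[R]_n) (k : 'rV[R]_n) (i1 : 'I_n).
Hypotheses (QO : orthomx Q) (QE : hyp_shape u x0 = Q^T *m diag_mx k *m Q).
Hypothesis k_sum : \sum_i c i * k ord0 i = sigma.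
Hypothesis k_max : k ord0 i1 = M * ((wD D x0)^-1 - a).

Lemma spatial_max_bound : M <= 4 / a ^+ 3.
Proof.
have Ux0 := OmU Omx0.
have w0 := wD_gt0 D x0; have wn : wD D x0 != 0 by rewrite gt_eqF.
have u0 : 0 < D [::] x0 by rewrite -D0E u_gt0.
have un : D [::] x0 != 0 by rewrite gt_eqF.
(* gamma is the inverse of [groot], so orthonormal eigenvectors become a [gmet]-orthonormal frame;
   solving kappa = nu + u b gives the Euclidean curvatures. *)
pose E i := row i Q *m gammamx u x0.
pose b i := (k ord0 i - (wD D x0)^-1) / D [::] x0.
have gE i : groot D x0 (E i) = row i Q by exact: gamma_groot (D1E x0) _.
have Eo i j : gmet D x0 (E i) (E j) = (i == j)%:R.
  by rewrite -(groot_dot cD Ux0) !gE dotv_row_orth.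
have Eh i v : D [:: E i; v] x0 = wD D x0 * b i * gmet D x0 (E i) v.
  have := shapeD (E i) v Omx0; rewrite gE (row_eigen QO QE) dotvZl -gE (groot_dot cD Ux0) D0E => h.
  apply: (mulfI un); rewrite /b; apply: (addrI (gmet D x0 (E i) v)); rewrite -h; field.
  by rewrite un wn.
have kapE i : (wD D x0)^-1 + D [::] x0 * b i = k ord0 i by rewrite /b; field; rewrite un wn.
have k0 := (spectrum Omx0 QO QE).1.
apply: (@interior_max_bound R n U D cD x0 i1 E b c M a (c i1 * (M * a) + sigma) (frame_const i1)) => //.
- by apply: filterS (open_nbhs_nbhs (conj oOm Omx0)) => x Ox xi; exact: quadD.
- have h : (wD D x0)^-1 + D [::] x0 * b i1 = M * ((wD D x0)^-1 - a) by rewrite kapE.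
  have : wD D x0 * (wD D x0)^-1 + D [::] x0 * wD D x0 * b i1 =
    M * (wD D x0 * (wD D x0)^-1) - M * a * wD D x0 by move: (congr1 ( *%R (wD D x0)) h); lra.
  by rewrite mulfV //; lra.
- exact: frame_const_ge0.
- by apply: filterS (open_nbhs_nbhs (conj oOm Omx0)) => x Ox eps P; exact: frame_fun_ge.
- rewrite /frame_fun.
  have -> : \sum_(i | i != i1) c i * (1 + D [::] x0 * D [:: E i; E i] x0) =
     wD D x0 * (\sum_(i | i != i1) c i * k ord0 i).
    rewrite big_distrr /=; apply: eq_bigr => i _; rewrite Eh Eo eqxx mulr1n -kapE; field.
    by rewrite wn.
  by move: k_sum; rewrite (bigD1 i1) //= k_max => <-; field.
- by move=> i; rewrite kapE.
- exact: nu_ge.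
Qed.

End AtMaximum.

(** * Continuity of the shape operator *)

Section ShapeContinuity.
Variables (R : realType) (n : nat) (U : set 'rV[R]_n) (u : 'rV[R]_n -> R) (x : 'rV[R]_n).
Hypotheses (su : smooth_on U u) (Ux : U x).

Lemma cont_ext (T : topologicalType) (z : T) (f g : T -> R) : f =1 g -> cont_at z f -> cont_at z g.
Proof. by move=> /funext ->. Qed.

Lemma cont_mulmx (T : topologicalType) (z : T) (A B : T -> 'M[R]_n) :
  (forall i j, cont_at z (fun y => A y i j)) -> (forall i j, cont_at z (fun y => B y i j)) ->
  forall i j, cont_at z (fun y => (A y *m B y) i j).
Proof.
move=> cA cB i j; apply: (@cont_ext _ _ (fun y => \sum_k A y i k * B y k j)) => [y|].
  by rewrite mxE.
by apply: cont_sum => k; apply: cont_mul.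
Qed.

Lemma cont_Du i : cont_at x (fun y => Du u y i).
Proof. exact: (differentiable_continuous (@su [:: ebas R i] x Ux)). Qed.

Lemma cont_wgraph : cont_at x (wgraph u).
Proof.
apply: cont_sqrt; apply: cont_add; first exact: cont_cst.
apply: cont_sum => i; apply: (@cont_ext _ _ (fun y => Du u y i * Du u y i)) => [y|].
  by rewrite expr2.
by apply: cont_mul; exact: cont_Du.
Qed.

Lemma wgraph_gt0 y : 0 < wgraph u y.
Proof. by rewrite sqrtr_gt0 ltr_wpDr // sumr_ge0 // => i _; rewrite sqr_ge0. Qed.

Lemma cont_nu_last : cont_at x (nu_last u).
Proof. by apply: cont_inv; [rewrite gt_eqF // wgraph_gt0|exact: cont_wgraph]. Qed.

Lemma cont_hyp_shape i j : cont_at x (fun y => hyp_shape u y i j).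
Proof.
have cw := cont_wgraph.
have cg k l : cont_at x (fun y => gammamx u y k l).
  apply: (@cont_ext _ _ (fun y => (k == l)%:R - Du u y k * Du u y l * (wgraph u y * (1 + wgraph u y))^-1)).
    by move=> y; rewrite mxE.
  apply: cont_sub; first exact: cont_cst.
  apply: cont_mul; first by apply: cont_mul; exact: cont_Du.
  apply: cont_inv; first by rewrite gt_eqF // mulr_gt0 ?addr_gt0 ?wgraph_gt0.
  by apply: cont_mul => //; apply: cont_add => //; exact: cont_cst.
have cD k l : cont_at x (fun y => D2u u y k l).
  have -> : (fun y => D2u u y k l) = iterD u [:: ebas R k; ebas R l].
    by apply/funext => y; rewrite mxE.
  exact: (differentiable_continuous (@su [:: ebas R k; ebas R l] x Ux)).
apply: (@cont_ext _ _ (fun y => nu_last u y * (1%:M : 'M[R]_n) i j +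
    u y * (wgraph u y)^-1 * (gammamx u y *m D2u u y *m gammamx u y) i j)).
  by move=> y; rewrite /hyp_shape [RHS]mxE [X in _ = X + _]mxE [X in _ = _ + X]mxE.
apply: cont_add; first by apply: cont_mul; [exact: cont_nu_last|exact: cont_cst].
apply: cont_mul.
  apply: cont_mul; first exact: (differentiable_continuous (@su [::] x Ux)).
  by apply: cont_inv => //; rewrite gt_eqF // wgraph_gt0.
exact: cont_mulmx (cont_mulmx cg cD) cg i j.
Qed.

End ShapeContinuity.

Lemma interior_rayleigh_max (R : realType) (n : nat) (f : 'rV[R]_n -> R) (sigma a M : R)
    (Om : set 'rV[R]_n) (u : 'rV[R]_n -> R) (U : set 'rV[R]_n) D (x0 xi0 : 'rV[R]_n) :
  calculus U D -> (forall x, u x = D [::] x) -> (forall x i, Du u x i = D [:: ebas R i] x) ->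
  (forall x i j, D2u u x i j = D [:: ebas R i; ebas R j] x) ->
  structure_conditions f -> open Om -> Om `<=` U -> (forall x, Om x -> 0 < u x) ->
  (forall x kappa, Om x -> principal_curvatures u x kappa -> forall i, 0 < kappa ord0 i) ->
  (forall x kappa, Om x -> principal_curvatures u x kappa -> f kappa = sigma) ->
  0 < a -> 0 < M -> (forall x, Om x -> 2 * a <= nu_last u x) ->
  (forall x xi, Om x -> dotv xi xi = 1 -> dotv (xi *m hyp_shape u x) xi <= M * (nu_last u x - a)) ->
  Om x0 -> dotv xi0 xi0 = 1 -> dotv (xi0 *m hyp_shape u x0) xi0 = M * (nu_last u x0 - a) ->
  M <= 4 / a ^+ 3.
Proof.
move=> cD D0E D1E D2E sc oOm OmU u0 kpos kf a0 M0 nuge hle Ox0 xi1 hmax.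
have nuE x : nu_last u x = (wD D x)^-1 by rewrite /nu_last (wgraphE (D1E x)).
have pc x (Q : 'M[R]_n) k : orthomx Q -> hyp_shape u x = Q^T *m diag_mx k *m Q ->
    principal_curvatures u x k by exact: spectral_char_poly.
have [Q [k [QO QE]]] := sym_spectral (shape_tr cD (D2E x0) (OmU _ Ox0)).
have kK : Kpos k := kpos _ _ Ox0 (pc _ _ _ QO QE).
have [c [c0 cs cf]] := structure_weights sc kK.
have [j0 _|no] := pickP (fun _ : 'I_n => true); last first.
  by move: xi1; rewrite /dotv big_pred0 // => /esym/eqP; rewrite oner_eq0.
pose i1 := [arg max_(i > j0) k ord0 i]%O.
have i1P i : k ord0 i <= k ord0 i1 by rewrite /i1; case: arg_maxP => // m _ h; exact: h.
(* The maximal Rayleigh quotient at x0 is the largest eigenvalue, so the maximizing vector may be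
   taken in the principal frame. *)
have ki1 : k ord0 i1 = M * ((wD D x0)^-1 - a).
  apply/eqP; rewrite eq_le; apply/andP; split.
    have := hle x0 (row i1 Q) Ox0; rewrite (dotv_row_orth QO) eqxx => /(_ erefl).
    by rewrite (row_eigen QO QE) dotvZl (dotv_row_orth QO) eqxx mulr1 nuE.
  rewrite -nuE -hmax (spectral_quad QE) -[leRHS]mulr1 -xi1 [in leRHS](spectral_norm QO) big_distrr /=.
  by apply: ler_sum => i _; rewrite ler_wpM2r ?sqr_ge0.
apply: (@spatial_max_bound R n U u D cD D0E D1E D2E Om x0 a M sigma c oOm OmU Ox0 u0 a0 M0
  _ c0 _ _ Q k i1 QO QE _ ki1).
- by move=> x Ox; rewrite -nuE; exact: nuge.
- by move=> x xi Ox h; rewrite -nuE; exact: hle.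
- move=> x P l Ox PO PE; have lK : Kpos l := kpos _ _ Ox (pc _ _ _ PO PE).
  by split => // s; rewrite -(kf _ _ Ox (pc _ _ _ PO PE)); exact: cf.
- by rewrite cs; exact: kf _ _ Ox0 (pc _ _ _ QO QE).
Qed.

Theorem theorem4p1 (R : realType) (n : nat) (f : 'rV[R]_n -> R) (sigma a : R)
    (Om : set 'rV[R]_n) (u : 'rV[R]_n -> R) :
  (0 < n)%N ->
  structure_conditions f ->
  0 < sigma < 1 ->
  bounded_domain Om ->
  smooth_up_to_boundary Om u ->
  (forall x, closure Om x -> 0 < u x) ->
  (forall x kappa, closure Om x -> principal_curvatures u x kappa ->
     forall i, 0 < kappa ord0 i) ->
  (forall x kappa, closure Om x -> principal_curvatures u x kappa ->
     f kappa = sigma) ->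
  0 < a ->
  (forall x, closure Om x -> 2 * a <= nu_last u x) ->
  forall x, closure Om x ->
    kappa_max u x / (nu_last u x - a) <= 4 * n%:R / a ^+ 3 \/
    exists2 y, (closure Om `\` Om) y &
      kappa_max u x / (nu_last u x - a) <= kappa_max u y / (nu_last u y - a).
Proof.
move=> n0 sc _ [oOm [_ [bOm OmN]]] [U [oU [cU su]]] u0 kpos kf a0 nuge x cx.
have cD := iterD_calculus oU su.
have D1E y i : Du u y i = iterD u [:: ebas R i] y by [].
have D2E y i j : D2u u y i j = iterD u [:: ebas R i; ebas R j] y by rewrite mxE.
have symA y (cy : closure Om y) := shape_tr cD (D2E y) (cU _ cy).
have h0 y : closure Om y -> 0 < nu_last u y - a by move=> /nuge; lra.
have [] := @max_rayleigh R n n0 (closure Om) (hyp_shape u) (fun y => nu_last u y - a).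
- exact: closure_compact.
- by case: OmN => y Oy; exists y; exact: subset_closure.
- by move=> y i j /cU Uy; exact: cont_hyp_shape su Uy i j.
- by move=> y /cU Uy; apply: cont_sub; [exact: cont_nu_last su Uy|exact: cont_cst].
- exact: h0.
move=> x0 [xi0 [cx0 xi1]]; set M := dotv _ _ / _ => hM.
have hle y xi : closure Om y -> dotv xi xi = 1 ->
    dotv (xi *m hyp_shape u y) xi <= M * (nu_last u y - a).
  by move=> cy h; rewrite -ler_pdivrMr ?h0 //; exact: hM.
have hx : kappa_max u x / (nu_last u x - a) <= M.
  rewrite ler_pdivrMr ?h0 //; apply: (eigenvalue_sup_le n0 (symA x cx)) => xi.
  exact: hle.
have [ML|ML] := leP M (4 * n%:R / a ^+ 3); first by left; exact: le_trans ML.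
(* A maximum point outside the open set lies on the boundary and serves as the witness for every
   x. *)
have [Ox0|nOx0] := pselect (Om x0); last first.
  right; exists x0; first by split.
  apply: (le_trans hx); rewrite /M ler_pM2r ?invr_gt0 ?h0 //.
  exact: (eigenvalue_sup_ge (symA x0 cx0)).
exfalso; suff : M <= 4 * n%:R / a ^+ 3 by rewrite leNgt ML.
have sub y : Om y -> closure Om y by exact: subset_closure.
have M0 : 0 < M.
  by apply: le_lt_trans ML; rewrite divr_ge0 ?exprn_ge0 ?(ltW a0) // mulr_ge0.
(* The interior estimate has the constant 4 / a^3, and n >= 1. *)
apply: (@le_trans _ _ (4 / a ^+ 3)); last first.
  rewrite ler_pM2r ?invr_gt0 ?exprn_gt0 // -[leLHS]mulr1 ler_pM2l // ler1n //.
apply: (interior_rayleigh_max (x0 := x0) (xi0 := xi0) cD _ D1E D2E sc oOm) => //.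
- by move=> y /sub; exact: cU.
- by move=> y /sub; exact: u0.
- by move=> y l /sub cy; exact: kpos.
- by move=> y l /sub cy; exact: kf.
- by move=> y /sub; exact: nuge.
- by move=> y xi /sub; exact: hle.
- by rewrite /M divfK // gt_eqF // h0.
Qed.
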